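(* Let $R=\mathbb K[x_0,\dots,x_n]$ with $\mathbb K$ a field (i.e. $A=\mathbb K$), and let $I\subset R$ be a componentwise linear ideal. Then there exists a non-empty Zariski open subset of the space $\mathrm{GL}_{n+1}$ of linear changes of coordinates such that, for every $\mathbb K$-rational linear change of coordinates $g$ in it, $g(I)$ is generated by a $J$-marked basis for some stable ideal $J$, and the $J$-resolution of $g(I)$ is minimal.
   Context: $R$ has the standard grading and $x_0<\dots<x_n$. A graded ideal $I$ is componentwise linear if, for every degree $d\ge0$, the ideal $(I_d)$ generated by the degree-$d$ component of $I$ has a linear resolution, i.e. its only possibly non-vanishing graded Betti numbers are $\beta_{i,i+d}$, $i=0,1,\dots$. A term of $R$ is a monomial $x^\alpha$; for $x^\alpha\neq1$, $\min(x^\alpha)$ is the smallest variable dividing it. Variables $x_i>\min(x^\alpha)$ are non-multiplicative for $x^\alpha$ (the term $1$ has no non-multiplicative variables). The same notions apply to terms $x^\alpha\mathbf e_k$ of a graded free module $\bigoplus_kR(-d_k)\mathbf e_k$ (using $x^\alpha$). For a monomial submodule (or ideal) $U$, $\mathcal N(U)$ is the set of terms not in $U$. Pommaret cone: $\mathcal C(x^\alpha)=\{x^\delta x^\alpha\mid\delta_i=0\ \forall x_i>\min(x^\alpha)\}$ for $x^\alpha\neq 1$, $\mathcal C(1)=$ all terms, $\mathcal C(x^\alpha\mathbf e_k)=\mathcal C(x^\alpha)\mathbf e_k$. A Pommaret basis of $U$ is a set of terms generating $U$ whose cones partition the set of terms of $U$; it is unique if it exists, denoted $\mathcal P_U$.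 $U$ is quasi-stable if it has a finite Pommaret basis, stable if moreover $\mathcal P_U$ is its minimal monomial generating set. A $U$-marked set is a finite set $F=\{f_\tau\}_{\tau\in\mathcal P_U}$ of homogeneous elements such that $\tau$ has coefficient $1$ in $f_\tau$ and the support of $f_\tau-\tau$ is contained in $\mathcal N(U)$. It is a $U$-marked basis if, for all $s$, the degree-$s$ part of the ambient free module is $(F)_s\oplus\langle\mathcal N(U)_s\rangle_{\mathbb K}$. Then each $f\in(F)$ has a unique writing $f=\sum_{\tau\in\mathcal P_U} P_\tau f_\tau$ with $P_\tau\in R$ and all terms of $P_\tau\tau$ in $\mathcal C(\tau)$. $U$-resolution of $M=(F)$: let $P_0=\bigoplus_{\tau\in\mathcal P_U}R(-\deg\tau)\mathbf f_\tau$ and $\partial_0(\mathbf f_\tau)=f_\tau$. For $\tau\in\mathcal P_U$ and $x_i$ non-multiplicative for $\tau$, the fundamental syzygy is $S_{i,\tau}=x_i\mathbf f_\tau-\sum P_\sigma\mathbf f_\sigma$, where $x_if_\tau=\sum P_\sigma f_\sigma$ is the unique writing. The set $F^{\partial_1}$ of fundamental syzygies is a marked basis (head term of $S_{i,\tau}$: $x_i\mathbf f_\tau$) of $\ker\partial_0$ over the stable module with Pommaret basis $\{x_i\mathbf f_\tau\mid x_i\text{ non-multiplicative for }\tau\}$. Iterating (known), $F^{\partial_t}$, the set of fundamental syzygies of $F^{\partial_{t-1}}$ (with $F^{\partial_0}=F$), is a marked basis of $\ker\partial_{t-1}$ over a stable module, and $\partial_t:P_t\to P_{t-1}$ is the homomorphism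 whose matrix has the elements of $F^{\partial_t}$ as columns. The resulting finite graded free resolution is the $U$-resolution of $M$ (here $U=J$, $M=g(I)$). It is minimal if no matrix entry of $\partial_t$, $t\ge1$, is a non-zero constant. *)

(* Defs.v *)
From HB Require Import structures.
From mathcomp Require Import all_boot all_order all_algebra.
From mathcomp Require Export mpoly.

Set Implicit Arguments.
Unset Strict Implicit.
Unset Printing Implicit Defensive.

Import GRing.Theory.
Local Open Scope ring_scope.

(* The polynomial ring K[x_0, ..., x_n] is {mpoly K[n.+1]}.  Ideals are
   Prop-valued predicates, so that no decidability of membership or finite
   generation is presupposed; two ideals are equal when they have the same
   members. *)

Section Ideals.
Variables (n : nat) (K : fieldType).
Notation R := {mpoly K[n.+1]}.

Definition is_ideal (I : R -> Prop) : Prop :=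
  [/\ I 0, (forall f g, I f -> I g -> I (f + g))
         & (forall a f, I f -> I (a * f))].

Definition graded_ideal (I : R -> Prop) : Prop :=
  is_ideal I /\ (forall f d, I f -> I (pihomog mdeg d f)).

Definition monomial_ideal (I : R -> Prop) : Prop :=
  is_ideal I /\ (forall f m, I f -> m \in msupp f -> I 'X_[m]).

Definition ideal_gen (G : R -> Prop) (f : R) : Prop :=
  exists (r : nat) (a g : 'I_r -> R),
    (forall i, G (g i)) /\ f = \sum_(i < r) a i * g i.

Definition generates (G I : R -> Prop) : Prop :=
  forall f, I f <-> ideal_gen G f.

Definition ideal_of_degree (I : R -> Prop) (d : nat) : R -> Prop :=
  ideal_gen (fun f => I f /\ f \is d.-homog).

End Ideals.

Section Complexes.
Variables (n : nat) (K : fieldType).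
Notation R := {mpoly K[n.+1]}.

(* Complexes  ... -> P_2 -> P_1 -> P_0 -> R  augmented to the ring R: the free
   module P_t has the basis 'I_(rk t) with degrees dg t, the matrix of d_0 is
   the row of images in R, and that of d_t.+1 : P_t.+1 -> P_t acts on columns.
   tgt_rk rk t is the rank of the target of d_t. *)
Definition tgt_rk (rk : nat -> nat) (t : nat) : nat :=
  if t is s.+1 then rk s else 1%N.

Record complex := Complex {
  rk : nat -> nat;
  dg : forall t, 'I_(rk t) -> nat;
  dif : forall t, 'M[R]_(tgt_rk rk t, rk t)
}.

Definition tgt_dg (C : complex) (t : nat) : 'I_(tgt_rk (rk C) t) -> nat :=
  match t with
  | 0 => fun _ => 0%N
  | s.+1 => @dg C s
  end.

Definition homogeneous_maps (C : complex) : Prop :=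
  forall t i j m, m \in msupp (dif C t i j) ->
    (mdeg m + tgt_dg i = @dg C t j)%N.

Definition graded_free_resolution (C : complex) (I : R -> Prop) : Prop :=
  [/\ homogeneous_maps C,
      (forall f, I f <-> exists u : 'cV[R]_(rk C 0), f = (dif C 0 *m u) ord0 ord0)
    & (forall t (u : 'cV[R]_(rk C t)),
        dif C t *m u = 0 <->
        exists v : 'cV[R]_(rk C t.+1), u = dif C t.+1 *m v)].

(* Entries of d_0 may be constants, as for the unit ideal. *)
Definition minimal (C : complex) : Prop :=
  forall t i j (c : K), dif C t.+1 i j = c%:MP -> c = 0.

Definition betti (C : complex) (i j : nat) : nat :=
  #|[pred k : 'I_(rk C i) | dg k == j]|.

(* The graded Betti numbers of an ideal are those of its minimal graded free
   resolution, which exists and is unique up to isomorphism. *)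
Definition has_linear_resolution (I : R -> Prop) (d : nat) : Prop :=
  exists C : complex,
    [/\ graded_free_resolution C I, minimal C
      & forall i j, betti C i j != 0%N -> j = (i + d)%N].

Definition componentwise_linear (I : R -> Prop) : Prop :=
  graded_ideal I /\
  (forall d, has_linear_resolution (ideal_of_degree I d) d).

End Complexes.

Section Pommaret.
Variable n : nat.

(* Index of the smallest variable dividing x^m; it is n.+1, the number of
   variables, for m = 0, so that the term 1 has no non-multiplicative
   variable. *)
Definition minvar (m : 'X_{1..n.+1}) : nat := find (fun e => e != 0%N) m.

Definition nonmult (m : 'X_{1..n.+1}) (i : 'I_n.+1) : bool := (minvar m < i)%N.

Definition in_cone (m t : 'X_{1..n.+1}) : Prop :=
  exists d : 'X_{1..n.+1},
    t = (d + m)%MM /\ (forall i, nonmult m i -> d i = 0%N).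

Variable K : fieldType.
Notation R := {mpoly K[n.+1]}.

Definition monomials (P : seq 'X_{1..n.+1}) (f : R) : Prop :=
  exists2 m, m \in P & f = 'X_[m].

Definition pommaret_basis (J : R -> Prop) (P : seq 'X_{1..n.+1}) : Prop :=
  [/\ uniq P,
      generates (monomials P) J,
      (forall m, J 'X_[m] <-> exists2 t, t \in P & in_cone t m)
    & (forall t s m, t \in P -> s \in P -> in_cone t m -> in_cone s m -> t = s)].

Definition minimal_generators (J : R -> Prop) (P : seq 'X_{1..n.+1}) : Prop :=
  generates (monomials P) J /\
  (forall Q : seq 'X_{1..n.+1}, {subset Q <= P} ->
     generates (monomials Q) J -> {subset P <= Q}).

Definition stable (J : R -> Prop) : Prop :=
  monomial_ideal J /\
  (exists P, pommaret_basis J P /\ minimal_generators J P).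

(* The elements of a marked set over P are F t for t in P; the values of F
   outside P are irrelevant. *)
Definition marked_elements (P : seq 'X_{1..n.+1}) (F : 'X_{1..n.+1} -> R)
    (f : R) : Prop :=
  exists2 t, t \in P & f = F t.

Definition supp_outside (J : R -> Prop) (f : R) : Prop :=
  forall m, m \in msupp f -> ~ J 'X_[m].

Definition marked_set (J : R -> Prop) (P : seq 'X_{1..n.+1})
    (F : 'X_{1..n.+1} -> R) : Prop :=
  pommaret_basis J P /\
  (forall t, t \in P ->
     [/\ F t \is (mdeg t).-homog, (F t)@_t = 1
       & supp_outside J (F t - 'X_[t])]).

Definition marked_basis (J : R -> Prop) (P : seq 'X_{1..n.+1})
    (F : 'X_{1..n.+1} -> R) : Prop :=
  [/\ marked_set J P F,
      (forall s (p : R), p \is s.-homog ->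
         exists q r : R,
           [/\ ideal_gen (marked_elements P F) q /\ q \is s.-homog,
               supp_outside J r /\ r \is s.-homog
             & p = q + r])
    & (forall s (p : R), p \is s.-homog ->
         ideal_gen (marked_elements P F) p -> supp_outside J p -> p = 0)].

(* S is the fundamental syzygy S_{i,k} of the columns of A, where h k is the
   monomial part of the head term of column k (its module component plays no
   role for cones). *)
Definition fundamental_syzygy (p r : nat) (A : 'M[R]_(p, r))
    (h : 'I_r -> 'X_{1..n.+1}) (i : 'I_n.+1) (k : 'I_r) (S : 'cV[R]_r) : Prop :=
  exists Q : 'cV[R]_r,
    [/\ 'X_i *: col k A = A *m Q,
        (forall l m, m \in msupp (Q l ord0) -> in_cone (h l) (m + h l)%MM)
      & S = 'X_i *: delta_mx k ord0 - Q].

(* C is, up to the numbering of the bases, the resolution built from the marked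
   basis (F t), t in P.  hd t k = (m, c) is the head term x^m e_c of the k-th
   column of d_t, for the basis (e_c) of the target of d_t. *)
Definition marked_resolution (P : seq 'X_{1..n.+1}) (F : 'X_{1..n.+1} -> R)
    (C : complex n K) : Prop :=
  exists hd : forall t, 'I_(rk C t) -> 'X_{1..n.+1} * 'I_(tgt_rk (rk C) t),
    [/\ (forall t, injective (hd t)) /\
        (forall t k, dg k = mdeg (hd t k).1 + tgt_dg (hd t k).2)%N,
        (forall m, m \in P <-> exists k, (hd 0 k).1 = m),
        (forall k, dif C 0 ord0 k = F (hd 0 k).1),
        (forall t m (k : 'I_(rk C t)),
           (exists l, hd t.+1 l = (m, k)) <->
           (exists2 i, nonmult (hd t k).1 i & m = U_(i)%MM))
      & (forall t l i (k : 'I_(rk C t)), hd t.+1 l = (U_(i)%MM, k) ->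
           fundamental_syzygy (dif C t) (fun j => (hd t j).1) i k
             (col l (dif C t.+1)))].

End Pommaret.

Section Coordinates.
Variables (n : nat) (K : fieldType).
Notation R := {mpoly K[n.+1]}.

Definition change_coord (g : 'M[K]_n.+1) (f : R) : R :=
  f \mPo [tuple \sum_(j < n.+1) g i j *: 'X_j | i < n.+1].

Definition image_ideal (g : 'M[K]_n.+1) (I : R -> Prop) (f : R) : Prop :=
  exists2 f0, I f0 & f = change_coord g f0.

(* A Zariski open subset of the K-variety GL_{n+1} is the complement of the
   zero set of a set Z of polynomials over K in the matrix entries.  As K may be
   finite, it is identified with its points over all extension fields L of K,
   and it is non-empty when it has a point over some L (it might still lack
   K-rational points). *)
Definition open_point (Z : {mpoly K[n.+1 * n.+1]} -> Prop) (L : fieldType)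
    (iota : {rmorphism K -> L}) (g : 'M[L]_n.+1) : Prop :=
  g \in unitmx /\ exists2 p, Z p & mmap iota (fun k => mxvec g ord0 k) p != 0.

Definition open_nonempty (Z : {mpoly K[n.+1 * n.+1]} -> Prop) : Prop :=
  exists (L : fieldType) (iota : {rmorphism K -> L}) (g : 'M[L]_n.+1),
    open_point Z iota g.

Definition open_rational_point (Z : {mpoly K[n.+1 * n.+1]} -> Prop)
    (g : 'M[K]_n.+1) : Prop :=
  open_point Z (idfun : {rmorphism K -> K}) g.

End Coordinates.

(* Main.v *)
From HB Require Import structures.
Require Import Defs.
From mathcomp Require Import all_boot all_order all_algebra.
From mathcomp Require Import zify generic_quotient.
From Stdlib Require Import ClassicalEpsilon.

Set Implicit Arguments.
Unset Strict Implicit.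
Unset Printing Implicit Defensive.

Import Order.TTheory GRing.Theory.
Local Open Scope ring_scope.

(** Why the theorem is true.  Order the terms of each degree by the degree
    reverse lexicographic order in which x_0 is the smallest variable.  Inside
    one degree this is the reverse of the order [<=%O] on terms, so the leading
    term of a form f is [mlast f].  For generic g the theorem holds with J the
    ideal of the leading terms of g(I) and with F the reduced elements of g(I)
    marked on the Pommaret basis of J.

    Everything follows from one cancellation property of A = g(I), for all d, k:
    if a is a form of degree d and x_k a lies in (A_d) + (x_0, ..., x_{k-1}),
    then a lies in A_d + (x_0, ..., x_{k-1}).  Let f in A_d have a leading
    term x_k t whose smallest variable is x_k.  Modulo the smaller variables
    f = x_k a with a form a of leading term t, and x_i f = x_k (x_i a) for i > k, so
    that x_i t is again a leading term: J is stable ([lead_set_stable]), and its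
    minimal generators are a Pommaret basis ([stable_cone],
    [stable_cone_uniq]).  Applied to the product of a variable and a form of
    A_d, the same division shows that the leading terms of (A_d) in degree
    d + 1 are the multiplicative multiples of those in A_d.  Hence x_i f_tau is
    rewritten with elements f_sigma such that deg sigma <= deg tau
    ([marked_row_rewritable]).

    This bound on degrees passes from each matrix of the resolution to the next
    ([syz_rewritable]).  A basis element of P_t lies over an element tau of P
    and has degree deg tau + t; a constant entry between basis elements over
    tau and sigma needs deg sigma = deg tau + 1, which the bound excludes.  So
    the resolution is minimal ([marked_resolution_exists]).

    The cancellation property is proved at the generic point: coordinates g with
    algebraically independent entries, over the field L of rational functions
    in them.  Let D be the linear resolution of (I_d) in these coordinates.  If
    the homology of D modulo (x_0, ..., x_{k-1}) is torsion with respect to the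
    variables, then a descending induction on k shows that it vanishes outside
    the constants, since x_k acts injectively on it; the cancellation property
    is a part of this ([linear_cancel]).  Torsion holds for generic coordinates
    because the substitution x_k -> x_k + s x_j, combined with a change of the
    entries of g, fixes the elements of g(I); comparing coefficients of
    powers of s in a relation x_k f = 0 modulo g(I) and the variables before x_k
    gives x_j^N f = 0 ([generic_torsion]).

    Finally J, F and the rewriting rules form finitely many elements of L[x]
    and identities between them.  Outside the zero set of their common
    denominator p they have values at g, and leading terms, supports and
    identities persist ([specialise_data]); so Z = {p} defines the open set. *)

(** * Terms, supports and cones *)

Section Supports.
Variables (n : nat) (R : comNzRingType).
Implicit Types (f g : {mpoly R[n]}) (S T U : 'X_{1..n} -> Prop).

Definition supported S f : Prop := forall m, m \in msupp f -> S m.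

Lemma supportedS S T f : (forall m, S m -> T m) -> supported S f -> supported T f.
Proof. by move=> ST Sf m /Sf/ST. Qed.

Lemma supported0 S : supported S 0.
Proof. by move=> m; rewrite mcoeff_msupp mcoeff0 eqxx. Qed.

Lemma supportedD S f g : supported S f -> supported S g -> supported S (f + g).
Proof.
by move=> Sf Sg m /msuppD_le; rewrite mem_cat => /orP [/Sf|/Sg].
Qed.

Lemma supportedN S f : supported S f -> supported S (- f).
Proof. by move=> Sf m; rewrite (perm_mem (msuppN _)) => /Sf. Qed.

Lemma supportedB S f g : supported S f -> supported S g -> supported S (f - g).
Proof. by move=> Sf Sg; apply: supportedD Sf (supportedN Sg). Qed.

Lemma supportedZ S c f : supported S f -> supported S (c *: f).
Proof. by move=> Sf m /msuppZ_le/Sf. Qed.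

Lemma supportedX S m : S m -> supported S 'X_[m].
Proof. by move=> Sm m' /mem_msuppXP <-. Qed.

Lemma supported_sum S (I : Type) (s : seq I) (P : pred I) (F : I -> {mpoly R[n]}) :
  (forall i, P i -> supported S (F i)) -> supported S (\sum_(i <- s | P i) F i).
Proof.
move=> SF; apply: (big_ind (supported S)) => //; first exact: supported0.
by move=> f g; apply: supportedD.
Qed.

Lemma supportedM S T U f g :
  (forall m m', S m -> T m' -> U (m + m')%MM) ->
  supported S f -> supported T g -> supported U (f * g).
Proof.
move=> STU Sf Tg m /msuppM_le /allpairsP [[m1 m2] /= [m1f m2g ->]].
by apply: STU; [apply: Sf | apply: Tg].
Qed.

Lemma homog_supported d f : f \is d.-homog <-> supported (fun m => mdeg m = d) f.
Proof. by split => [/dhomogP|] h; [move=> m /h | apply/dhomogP => m /h]. Qed.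

End Supports.

Lemma col_mulmx (T : pzRingType) p q r (A : 'M[T]_(p, q)) (B : 'M[T]_(q, r)) c :
  col c (A *m B) = A *m col c B.
Proof. by rewrite !colE mulmxA. Qed.

Lemma mxBE (T : pzRingType) p q (A B : 'M[T]_(p, q)) i j :
  (A - B) i j = A i j - B i j.
Proof. by rewrite !mxE. Qed.

Lemma nonmultP n (m : 'X_{1..n.+1}) (i : 'I_n.+1) :
  nonmult m i <-> exists2 l : 'I_n.+1, (l < i)%N & m l != 0%N.
Proof.
have sz : size (val (val m)) = n.+1 by rewrite size_tuple.
rewrite /nonmult; split=> [lt_i|[l li ml]].
  have hf : has (fun e => e != 0%N) m by rewrite has_find (leq_trans lt_i) // sz ltnW.
  have lt_a : (minvar m < n.+1)%N by apply: ltn_trans lt_i _.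
  by exists (Ordinal lt_a) => //; have := nth_find 0%N hf; rewrite -[find _ _]/(val (Ordinal lt_a)) -mnm_nth.
apply: leq_ltn_trans li; rewrite leqNgt; apply/negP => lt_l.
by have := before_find 0%N lt_l; rewrite -mnm_nth ml.
Qed.

Section Vectors.
Variables (n : nat) (K : fieldType).
Notation R := {mpoly K[n.+1]}.

(** For a product m h this says that it lies in the cone of h. *)
Definition multiplicative_for (h m : 'X_{1..n.+1}) : Prop :=
  forall i, nonmult h i -> m i = 0%N.

Definition cone_vec r (h : 'I_r -> 'X_{1..n.+1}) (u : 'cV[R]_r) : Prop :=
  forall l, supported (multiplicative_for (h l)) (u l ord0).

(** [lev] is the degree of the term of the Pommaret basis over which a basis
    vector lies.  A basis vector of the t-th module of the resolution has degree
    [lev + t], so [D] is the degree of [u] up to the shift by t.  The bound [d]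
    is what keeps constants out of the resolution. *)
Definition homog_upto r (lev : 'I_r -> nat) (D d : nat) (u : 'cV[R]_r) : Prop :=
  forall l, supported (fun m => mdeg m + lev l = D /\ lev l <= d)%N (u l ord0).

(** All fundamental syzygies of the columns exist, and they never use columns
    of a higher level. *)
Definition rewritable p r (A : 'M[R]_(p, r)) (h : 'I_r -> 'X_{1..n.+1})
    (lev : 'I_r -> nat) : Prop :=
  forall k i, nonmult (h k) i -> exists Q : 'cV[R]_r,
    [/\ 'X_i *: col k A = A *m Q, cone_vec h Q
      & homog_upto lev (lev k).+1 (lev k) Q].

(** Uniqueness of the writings with multiplicative coefficients. *)
Definition cone_free p r (A : 'M[R]_(p, r)) (h : 'I_r -> 'X_{1..n.+1}) : Prop :=
  forall v : 'cV[R]_r, A *m v = 0 -> cone_vec h v -> v = 0.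

Lemma rewritable_choice p r (A : 'M[R]_(p, r)) (h : 'I_r -> 'X_{1..n.+1}) lev :
  rewritable A h lev -> exists Q : 'I_r -> 'I_n.+1 -> 'cV[R]_r, forall k i, nonmult (h k) i ->
    [/\ 'X_i *: col k A = A *m Q k i, cone_vec h (Q k i)
      & homog_upto lev (lev k).+1 (lev k) (Q k i)].
Proof.
move=> hA; exists (fun k i => epsilon (inhabits 0) (fun Q => [/\ 'X_i *: col k A = A *m Q,
  cone_vec h Q & homog_upto lev (lev k).+1 (lev k) Q])) => k i /hA.
exact: epsilon_spec.
Qed.

Lemma cone_vec0 r (h : 'I_r -> 'X_{1..n.+1}) : cone_vec h 0.
Proof. by move=> l; rewrite mxE; apply: supported0. Qed.

Lemma cone_vecD r (h : 'I_r -> 'X_{1..n.+1}) u v :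
  cone_vec h u -> cone_vec h v -> cone_vec h (u + v).
Proof. by move=> hu hv l; rewrite mxE; apply: supportedD. Qed.

Lemma cone_vecZ r (h : 'I_r -> 'X_{1..n.+1}) (c : K) u :
  cone_vec h u -> cone_vec h (c%:MP *: u).
Proof. by move=> hu l; rewrite mxE mul_mpolyC; apply: supportedZ. Qed.

Lemma homog_upto0 r (lev : 'I_r -> nat) D d : homog_upto lev D d 0.
Proof. by move=> l; rewrite mxE; apply: supported0. Qed.

Lemma homog_uptoD r (lev : 'I_r -> nat) D d u v :
  homog_upto lev D d u -> homog_upto lev D d v -> homog_upto lev D d (u + v).
Proof. by move=> hu hv l; rewrite mxE; apply: supportedD. Qed.

Lemma homog_uptoN r (lev : 'I_r -> nat) D d u :
  homog_upto lev D d u -> homog_upto lev D d (- u).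
Proof. by move=> hu l; rewrite mxE; apply: supportedN. Qed.

Lemma homog_uptoZ r (lev : 'I_r -> nat) D d (c : K) u :
  homog_upto lev D d u -> homog_upto lev D d (c%:MP *: u).
Proof. by move=> hu l; rewrite mxE mul_mpolyC; apply: supportedZ. Qed.

Lemma homog_uptoX r (lev : 'I_r -> nat) D d m u :
  homog_upto lev D d u -> homog_upto lev (mdeg m + D)%N d ('X_[m] *: u).
Proof.
move=> hu l; rewrite mxE.
apply: (supportedM (S := eq m)); last exact: hu; last exact: supportedX.
by move=> _ m' <- [<- ?]; rewrite mdegD addnA.
Qed.

Lemma cone_vec_delta r (h : 'I_r -> 'X_{1..n.+1}) k m :
  multiplicative_for (h k) m -> cone_vec h ('X_[m] *: delta_mx k ord0).
Proof.
move=> hm l; rewrite !mxE eqxx andbT; case: eqP => [->|_].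
  by rewrite mulr1; apply: supportedX.
by rewrite mulr0; apply: supported0.
Qed.

Lemma homog_upto_delta r (lev : 'I_r -> nat) D d k m :
  (mdeg m + lev k = D)%N -> (lev k <= d)%N ->
  homog_upto lev D d ('X_[m] *: delta_mx k ord0).
Proof.
move=> hm hd l; rewrite !mxE eqxx andbT; case: eqP => [->|_].
  by rewrite mulr1; apply: supportedX.
by rewrite mulr0; apply: supported0.
Qed.

Lemma vec_terms r (u : 'cV[R]_r) :
  u = \sum_l \sum_(m <- msupp (u l ord0))
        ((u l ord0)@_m)%:MP *: ('X_[m] *: delta_mx l ord0).
Proof.
apply/matrixP => l j; rewrite (ord1 j) summxE (bigD1 l) //= [X in _ + X]big1 ?addr0.
  rewrite [LHS]mpolyE summxE; apply: eq_bigr => m _.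
  by rewrite !mxE !eqxx mulr1 mul_mpolyC.
move=> i il; rewrite summxE big1 // => m _.
by rewrite !mxE eq_sym (negbTE il) !mulr0.
Qed.

Section Weight.
Variable B : nat.

(** For exponents below [B] this number encodes the lexicographic order with
    x_n as most significant variable; rewriting a non-multiplicative multiple of
    a column decreases it. *)
Definition lex_weight (m : 'X_{1..n.+1}) : nat := \sum_i m i * B ^ i.

Lemma lex_weightD m m' :
  lex_weight (m + m')%MM = (lex_weight m + lex_weight m')%N.
Proof.
by rewrite /lex_weight -big_split; apply: eq_bigr => i _; rewrite mnmDE mulnDl.
Qed.

Lemma lex_weight1 i : lex_weight U_(i)%MM = (B ^ i)%N.
Proof.
rewrite /lex_weight (bigD1 i) //= mnm1E eqxx mul1n big1 ?addn0 // => j ji.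
by rewrite mnm1E eq_sym (negbTE ji).
Qed.

Lemma lex_weight_lt q (i : 'I_n.+1) : (mdeg q < B)%N ->
  (forall a, q a != 0%N -> (a < i)%N) -> (lex_weight q < lex_weight U_(i)%MM)%N.
Proof.
move=> qB qi; rewrite lex_weight1; case: i qi => [[|i] ltin] /= qi.
  rewrite expn0 ltnS leqn0 /lex_weight; apply/eqP; apply: big1 => a _.
  by case: (q a =P 0%N) => [->//|/eqP/qi].
apply: (@leq_ltn_trans (\sum_a q a * B ^ i)); last first.
  rewrite -big_distrl /= -mdegE expnS ltn_mul2r qB andbT expn_gt0.
  by rewrite (leq_ltn_trans _ qB).
apply: leq_sum => a _; case: (q a =P 0%N) => [->//|/eqP/qi ai].
by rewrite leq_mul2l leq_pexp2l ?orbT // (leq_ltn_trans _ qB).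
Qed.

End Weight.

Lemma max_var (m : 'X_{1..n.+1}) : m != 0%MM ->
  exists2 i : 'I_n.+1, m i != 0%N & forall a, m a != 0%N -> (a <= i)%N.
Proof.
move=> m0; have [a ha] : exists a, m a != 0%N.
  apply/existsP; apply: contraR m0; rewrite negb_exists => /forallP h.
  by apply/eqP/mnmP => a; rewrite mnm0E; apply/eqP; have := h a; rewrite negbK.
by case: (@arg_maxnP _ a (fun i => m i != 0%N) (fun i => val i) ha) => i hi hm; exists i.
Qed.

Lemma mnmU_split (m : 'X_{1..n.+1}) i : m i != 0%N ->
  exists m', m = (m' + U_(i))%MM.
Proof. by move=> mi; exists (m - U_(i))%MM; rewrite submK // lep1mP. Qed.

End Vectors.

(** * Generated ideals *)

Section IdealsGenerated.
Variables (n : nat) (K : fieldType).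
Notation R := {mpoly K[n.+1]}.
Implicit Types (G W : R -> Prop).

Lemma ideal_gen_in G f : G f -> ideal_gen G f.
Proof. by move=> Gf; exists 1%N, (fun _ => 1), (fun _ => f); split=> //; rewrite big_ord1 mul1r. Qed.

Lemma ideal_gen_ideal G : is_ideal (ideal_gen G).
Proof.
split.
- by exists 0%N, (fun _ => 0), (fun _ => 0); split=> [[]//|]; rewrite big_ord0.
- move=> _ _ [r1 [a1 [g1 [h1 ->]]]] [r2 [a2 [g2 [h2 ->]]]].
  exists (r1 + r2)%N, (fun i => match split i with inl i => a1 i | inr i => a2 i end),
    (fun i => match split i with inl i => g1 i | inr i => g2 i end); split.
    by move=> i; case: (split i).
  rewrite big_split_ord /=; congr (_ + _); apply: eq_bigr => i _.
    by rewrite (unsplitK (inl i)).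
  by rewrite (unsplitK (inr i)).
- move=> a _ [r [b [g [h ->]]]]; exists r, (fun i => a * b i), g; split=> //.
  by rewrite mulr_sumr; apply: eq_bigr => i _; rewrite mulrA.
Qed.

(** Keeps the explicit sums of [ideal_gen] out of all later arguments. *)
Lemma ideal_gen_min G W f : is_ideal W -> (forall g, G g -> W g) -> ideal_gen G f -> W f.
Proof.
move=> [W0 WD WM] GW [r [a [g [h ->]]]]; apply: (big_ind W) => // i _.
by apply/WM/GW.
Qed.

Definition row_image r (B : 'rV[R]_r) (f : R) : Prop :=
  exists u : 'cV[R]_r, f = (B *m u) ord0 ord0.

Lemma row_image_ideal r (B : 'rV[R]_r) : is_ideal (row_image B).
Proof.
split.
- by exists 0; rewrite mulmx0 mxE.
- by move=> _ _ [v ->] [v' ->]; exists (v + v'); rewrite mulmxDr [RHS]mxE.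
- by move=> c _ [v ->]; exists (c *: v); rewrite -scalemxAr [RHS]mxE.
Qed.

End IdealsGenerated.

(** * Syzygies of rewritable columns *)

Section Syzygies.
Variables (n : nat) (K : fieldType).
Notation R := {mpoly K[n.+1]}.
Variables (p r : nat) (A : 'M[R]_(p, r)) (h : 'I_r -> 'X_{1..n.+1}).
Variable lev : 'I_r -> nat.
Variable Q : 'I_r -> 'I_n.+1 -> 'cV[R]_r.
Hypothesis Q_eq : forall k i, nonmult (h k) i -> 'X_i *: col k A = A *m Q k i.
Hypothesis Q_cone : forall k i, nonmult (h k) i -> cone_vec h (Q k i).
Hypothesis Q_homog : forall k i, nonmult (h k) i ->
  homog_upto lev (lev k).+1 (lev k) (Q k i).
Hypothesis A_free : cone_free A h.

Definition syz_index : {set 'I_r * 'I_n.+1} := [set ki | nonmult (h ki.1) ki.2].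
Notation r' := #|syz_index|.
Definition syz_comp (c : 'I_r') : 'I_r := (enum_val c).1.
Definition syz_var (c : 'I_r') : 'I_n.+1 := (enum_val c).2.
Definition syz_vec (c : 'I_r') : 'cV[R]_r :=
  'X_(syz_var c) *: delta_mx (syz_comp c) ord0 - Q (syz_comp c) (syz_var c).
Definition syz_mx : 'M[R]_(r, r') := \matrix_(l, c) syz_vec c l ord0.
Definition syz_head (c : 'I_r') : 'X_{1..n.+1} := U_(syz_var c)%MM.
Definition syz_lev (c : 'I_r') : nat := lev (syz_comp c).

Lemma syz_nonmult c : nonmult (h (syz_comp c)) (syz_var c).
Proof. by have := enum_valP c; rewrite inE. Qed.

Lemma syz_exists k i : nonmult (h k) i ->
  exists2 c, syz_comp c = k & syz_var c = i.
Proof.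
move=> ki; have hk : (k, i) \in syz_index by rewrite inE.
by exists (enum_rank_in hk (k, i)); rewrite /syz_comp /syz_var enum_rankK_in.
Qed.

Lemma syz_inj c c' : syz_comp c = syz_comp c' -> syz_var c = syz_var c' -> c = c'.
Proof.
move=> h1 h2; apply: enum_val_inj; rewrite [LHS]surjective_pairing.
by rewrite [RHS]surjective_pairing; congr (_, _).
Qed.

Lemma col_syz_mx c : col c syz_mx = syz_vec c.
Proof. by apply/matrixP => l j; rewrite [LHS]mxE [LHS]mxE (ord1 j). Qed.

Lemma nonmult1 i j : nonmult (U_(i)%MM : 'X_{1..n.+1}) j = (i < j)%N.
Proof.
apply/idP/idP => [/nonmultP [l lj]|ij]; last first.
  by apply/nonmultP; exists i; rewrite ?mnm1E ?eqxx.
by rewrite mnm1E eqb0 negbK => /eqP ->.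
Qed.

Lemma A_mul_syz_mx : A *m syz_mx = 0.
Proof.
apply/matrixP => a c; rewrite [RHS]mxE -[LHS]/((A *m syz_mx) a c).
have -> : (A *m syz_mx) a c = (A *m col c syz_mx) a ord0.
  by rewrite -col_mulmx [RHS]mxE.
rewrite col_syz_mx /syz_vec mulmxBr -scalemxAr -colE.
by rewrite (Q_eq (syz_nonmult c)) subrr mxE.
Qed.

Section Reduction.
Variables D : nat.

(** Modulo the syzygies, [u] has only multiplicative terms. *)
Definition reducible (d : nat) (u : 'cV[R]_r) : Prop :=
  exists P : 'cV[R]_r', exists v : 'cV[R]_r,
    [/\ u = syz_mx *m P + v, cone_vec syz_head P, cone_vec h v
      & homog_upto syz_lev D d P].

Lemma reducible0 d : reducible d 0.
Proof.
exists 0, 0; rewrite mulmx0 addr0; split=> //; try exact: cone_vec0.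
exact: homog_upto0.
Qed.

Lemma reducibleD d u u' : reducible d u -> reducible d u' -> reducible d (u + u').
Proof.
move=> [P [v [-> h1 h2 h3]]] [P' [v' [-> h1' h2' h3']]].
exists (P + P'), (v + v'); rewrite mulmxDr addrACA; split=> //.
- exact: cone_vecD.
- exact: cone_vecD.
- exact: homog_uptoD.
Qed.

Lemma reducibleZ d (c : K) u : reducible d u -> reducible d (c%:MP *: u).
Proof.
move=> [P [v [-> h1 h2 h3]]]; exists (c%:MP *: P), (c%:MP *: v).
rewrite scalerDr scalemxAr; split=> //; [exact: cone_vecZ|exact: cone_vecZ|].
exact: homog_uptoZ.
Qed.

Lemma reducible_sum d (I : eqType) (s : seq I) (F : I -> 'cV[R]_r) :
  (forall i, i \in s -> reducible d (F i)) -> reducible d (\sum_(i <- s) F i).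
Proof.
move=> hF; rewrite big_seq; apply: (big_ind (reducible d)) => //.
- exact: reducible0.
- exact: reducibleD.
Qed.

(** Rewriting x_i m' e_k with the syzygy of head x_i e_k gives terms m' q e_l with q
    multiplicative for l.  If such a term is not multiplicative, then m' contains
    a variable x_j with j <= i which is not multiplicative for l; all variables of q
    are smaller than x_j, so that replacing x_i by q lowers the weight. *)
Lemma lower_term (l : 'I_r) (i : 'I_n.+1) (m' q : 'X_{1..n.+1}) B :
  multiplicative_for U_(i)%MM m' -> multiplicative_for (h l) q ->
  (mdeg q < B)%N -> ~ multiplicative_for (h l) (m' + q)%MM ->
  (lex_weight B (m' + q)%MM < lex_weight B (m' + U_(i))%MM)%N.
Proof.
move=> cm' cq qB ncm; have [j] : exists j, nonmult (h l) j && ((m' + q)%MM j != 0%N).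
  apply/existsP; apply: contra_notT ncm; rewrite negb_exists => /forallP hj j nj.
  by apply/eqP; have := hj j; rewrite nj negbK.
move=> /andP [nj]; rewrite mnmDE (cq _ nj) addn0 => m'j.
have ji : (j <= i)%N.
  rewrite leqNgt; apply/negP => ij; move: m'j; rewrite cm' ?eqxx //.
  by rewrite nonmult1.
rewrite !lex_weightD ltn_add2l; apply: lex_weight_lt => // a qa.
rewrite ltnNge; apply/negP => ia; move: qa; rewrite cq ?eqxx //.
by apply: leq_trans nj _; apply: leq_trans ji ia.
Qed.

(** Descent on the weight: the largest variable x_i of a non-multiplicative term
    is non-multiplicative, and the cofactor of x_i lies in the cone of the head
    x_i e_k of a syzygy, so one rewriting step is a legal division step. *)
Lemma reducible_term k m : (mdeg m + lev k = D.+1)%N ->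
  reducible (lev k) ('X_[m] *: delta_mx k ord0).
Proof.
(* All terms that occur have degree at most D + 1. *)
pose B := D.+2; move: {2}(lex_weight B m) (leqnn (lex_weight B m)) => N.
elim/ltn_ind: N k m => N IH k m mN mD.
have [cm|ncm] := classic (multiplicative_for (h k) m).
  exists 0, ('X_[m] *: delta_mx k ord0); rewrite mulmx0 add0r; split=> //.
  - exact: cone_vec0.
  - exact: cone_vec_delta.
  - exact: homog_upto0.
have m0 : m != 0%MM.
  by apply/eqP => m0; apply: ncm => i _; rewrite m0 mnm0E.
have [i mi imax] := max_var m0; have [m' Em] := mnmU_split mi; subst m.
have ki : nonmult (h k) i.
  apply: contra_notT ncm => nki j nj; apply/eqP; apply: contraR nki => mj.
  by apply: leq_trans nj _; apply: imax.
have [c ck ci] := syz_exists ki.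
have cm' : multiplicative_for U_(i)%MM m'.
  move=> j; rewrite nonmult1 => ij; apply/eqP; apply: contraTT ij => m'j.
  by rewrite -leqNgt imax // mnmDE addn_eq0 negb_and m'j.
have -> : 'X_[m' + U_(i)] *: delta_mx k ord0
   = syz_mx *m ('X_[m'] *: delta_mx c ord0) + 'X_[m'] *: Q k i.
  rewrite -scalemxAr -colE col_syz_mx /syz_vec ck ci scalerBr addrNK.
  by rewrite scalerA mpolyXD.
have degm' : (mdeg m' + lev k = D)%N.
  by move: mD; rewrite mdegD mdeg1 addn1 addSn => -[].
apply: reducibleD.
  exists ('X_[m'] *: delta_mx c ord0), 0; rewrite addr0; split=> //.
  - by apply: cone_vec_delta; rewrite /syz_head ci.
  - exact: cone_vec0.
  - by apply: homog_upto_delta; rewrite /syz_lev ck.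
rewrite (vec_terms (Q k i)) scaler_sumr; apply: reducible_sum => l _.
rewrite scaler_sumr; apply: reducible_sum => q qQ.
rewrite scalerA mulrC -scalerA [X in _ *: X]scalerA -mpolyXD; apply: reducibleZ.
have [qD lk] := Q_homog ki qQ.
have qB : (mdeg q < B)%N by rewrite /B; lia.
have mqD : (mdeg (m' + q)%MM + lev l = D.+1)%N by rewrite mdegD; lia.
have weak : reducible (lev l) ('X_[m' + q] *: delta_mx l ord0) ->
            reducible (lev k) ('X_[m' + q] *: delta_mx l ord0).
  move=> [P [v [E h1 h2 h3]]]; exists P, v; split=> // a.
  by apply: supportedS (h3 a) => a' [? ?]; split=> //; apply: leq_trans lk.
have [cmq|ncmq] := classic (multiplicative_for (h l) (m' + q)%MM).
  exists 0, ('X_[m' + q] *: delta_mx l ord0); rewrite mulmx0 add0r; split=> //.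
  - exact: cone_vec0.
  - exact: cone_vec_delta.
  - exact: homog_upto0.
apply: weak; apply: (IH (lex_weight B (m' + q)%MM)) => //.
by apply: leq_trans mN; apply: lower_term ncmq => //; apply: (Q_cone ki) qQ.
Qed.

Lemma reducible_vec d u : homog_upto lev D.+1 d u -> reducible d u.
Proof.
move=> hu; rewrite (vec_terms u); apply: reducible_sum => l _.
apply: reducible_sum => m mu; apply: reducibleZ; have [mD ld] := hu l m mu.
have [P [v [E h1 h2 h3]]] := reducible_term mD; exists P, v; split=> // a.
by apply: supportedS (h3 a) => a' [? ?]; split=> //; apply: leq_trans ld.
Qed.

End Reduction.

Lemma cone_writing_aux u : exists2 v, cone_vec h v & A *m u = A *m v.
Proof.
rewrite (vec_terms u).
pose W u := exists2 v, cone_vec h v & A *m u = A *m v.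
have W0 : W 0 by exists 0 => //; apply: cone_vec0.
have WD x y : W x -> W y -> W (x + y).
  move=> [v cv Ev] [w cw Ew]; exists (v + w); first exact: cone_vecD.
  by rewrite !mulmxDr Ev Ew.
apply: (big_ind W) => // k _; apply: (big_ind W) => // m _.
set c := _%:MP; suff [v cv Ev] : W ('X_[m] *: delta_mx k ord0).
  by exists (c *: v); [apply: cone_vecZ | rewrite -[LHS]scalemxAr -[RHS]scalemxAr Ev].
case E : (mdeg m + lev k)%N => [|D].
  exists ('X_[m] *: delta_mx k ord0) => //; apply: cone_vec_delta => i _.
  by move/eqP: E; rewrite addn_eq0 mdeg_eq0 => /andP [/eqP -> _]; rewrite mnm0E.
have [X [v [-> _ cv _]]] := reducible_term E; exists v => //.
by rewrite mulmxDr mulmxA A_mul_syz_mx mul0mx add0r.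
Qed.

(** x_j S reduces, modulo the syzygies, to a multiplicative vector in the kernel
    of [A]; that vector vanishes since writings are unique for [A].  Levels do not
    rise because the coefficients of S stay within the level of its head. *)
Lemma syz_rewritable : rewritable syz_mx syz_head syz_lev.
Proof.
move=> c j _; have kc := syz_nonmult c.
pose w : 'cV[R]_r := 'X_j *: col c syz_mx.
have hw : homog_upto lev (lev (syz_comp c)).+2 (lev (syz_comp c)) w.
  have -> : (lev (syz_comp c)).+2 = (mdeg U_(j)%MM + (lev (syz_comp c)).+1)%N.
    by rewrite mdeg1.
  rewrite /w col_syz_mx; apply: homog_uptoX; apply: homog_uptoD; last exact/homog_uptoN/Q_homog.
  by apply: homog_upto_delta => //; rewrite mdeg1.
have [P [v [E h1 h2 h3]]] := reducible_vec hw.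
exists P; split=> //; suff v0 : v = 0 by rewrite -[LHS]/w E v0 addr0.
apply: A_free => //; have : A *m w = 0.
  by rewrite /w -scalemxAr -col_mulmx A_mul_syz_mx; apply/matrixP => a b;
     rewrite !mxE mulr0.
by rewrite E mulmxDr mulmxA A_mul_syz_mx mul0mx add0r.
Qed.

(** In a relation between the syzygies with multiplicative coefficients, take a
    head term of the largest weight.  Heads cannot cancel among themselves, their
    cones being disjoint, and the remaining terms of the syzygies have smaller
    weights than the heads by [lower_term]. *)
Lemma syz_free : cone_free syz_mx syz_head.
Proof.
move=> P SP0 cP; apply/matrixP => c0 j; rewrite (ord1 j) [RHS]mxE => {j}.
apply/eqP/negPn/negP => Pc0.
(* Bounds the degrees of all terms of the rewriting vectors. *)
pose B := (\sum_c (lev (syz_comp c))).+2.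
pose wt c m := lex_weight B (m + U_(syz_var c))%MM.
(* Every head term is cancelled by a term below a head of larger weight. *)
have up N : exists c m, m \in msupp (P c ord0) /\ (N <= wt c m)%N.
  elim: N => [|N [c [m [mP Nm]]]].
    exists c0, (mlead (P c0 ord0)); split=> //; exact: mlead_supp.
  set i := syz_var c in Nm *; set k := syz_comp c; pose mu := (m + U_(i))%MM.
  have ki := syz_nonmult c; rewrite -/i -/k in ki.
  have cm : multiplicative_for (syz_head c) m by apply: cP mP.
  have : (('X_i * P c ord0) - \sum_c' Q (syz_comp c') (syz_var c') k ord0 * P c' ord0)@_mu = 0.
    suff E : (\sum_c' syz_mx k c' * P c' ord0)@_mu = 0.
      rewrite -[RHS]E mcoeffB ![(\sum_(_ < _) _)@__]raddf_sum /=.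
      have -> : \sum_c' (syz_mx k c' * P c' ord0)@_mu =
        \sum_c' ((syz_comp c' == k)%:R * ('X_(syz_var c') * P c' ord0)@_mu)
        - \sum_c' (Q (syz_comp c') (syz_var c') k ord0 * P c' ord0)@_mu.
        rewrite -sumrB; apply: eq_bigr => c' _; rewrite /syz_mx mxE /syz_vec !mxE.
        rewrite eqxx andbT mulrBl mcoeffB eq_sym; congr (_ - _).
        by case: eqP => _; rewrite ?mulr1 ?mul1r // mulr0 !mul0r mcoeff0.
      congr (_ - _); rewrite (bigD1 c) //= eqxx mul1r big1 ?addr0 // => c' cc'.
      case: eqP => [ck|]; rewrite ?mul0r // mul1r; apply/eqP.
      rewrite mcoeff_eq0; apply/negP => /msuppM_le /allpairsP [[x y] /= [xX yP Emu]].
      move/mem_msuppXP: xX => Ex; subst x.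
      have cy : multiplicative_for (syz_head c') y by apply: cP yP.
      have i'i : syz_var c' = i.
        apply/val_inj/eqP; rewrite eqn_leq; apply/andP; split.
          rewrite leqNgt; apply/negP => ii'.
          have := congr1 (fun z : 'X_{1..n.+1} => z (syz_var c')) Emu.
          rewrite !mnmDE !mnm1E eqxx cm ?nonmult1 // -val_eqE /=.
          by rewrite (ltn_eqF ii').
        rewrite leqNgt; apply/negP => ii'; have := congr1 (fun z : 'X_{1..n.+1} => z i) Emu.
        rewrite !mnmDE !mnm1E eqxx cy ?nonmult1 // -val_eqE /= (ltn_eqF ii').
        by rewrite addn1.
      by move/eqP: cc'; apply; apply: syz_inj.
    have := congr1 (fun M : 'cV_r => (M k ord0)@_mu) SP0.
    by rewrite /= !mxE mcoeff0.
  rewrite mcoeffB mulrC {1}/mu addmC mcoeffMX => /eqP; rewrite subr_eq0 => /eqP E.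
  have : \sum_c' (Q (syz_comp c') (syz_var c') k ord0 * P c' ord0)@_mu != 0.
    by move: mP; rewrite mcoeff_msupp E raddf_sum.
  have [c' hc'|all0] := pickP (fun c' => 
    (Q (syz_comp c') (syz_var c') k ord0 * P c' ord0)@_mu != 0); last first.
    by rewrite big1 ?eqxx // => c' _; apply/eqP; have := all0 c'; move/negbFE.
  move=> _; move: hc'; rewrite -mcoeff_msupp => /msuppM_le /allpairsP [[q m''] /= [qQ mP'' Emu]].
  exists c', m''; split=> //; apply: leq_ltn_trans Nm _.
  rewrite /wt -/i -[(m + U_(i))%MM]/mu Emu addmC.
  have kc' := syz_nonmult c'; have cq := Q_cone kc' qQ.
  have [qD _] := Q_homog kc' qQ.
  have qB : (mdeg q < B)%N.
    have : (lev (syz_comp c') <= \sum_c lev (syz_comp c))%N.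
      by rewrite (bigD1 c') //= leq_addr.
    by rewrite /B; lia.
  apply: (lower_term _ cq qB); first exact: cP mP''.
  move=> cmu; have := cmu i ki; rewrite addmC -Emu mnmDE mnm1E eqxx.
  by rewrite addn1.
pose M := \max_c \max_(m <- msupp (P c ord0)) wt c m.
have [c [m [mP]]] := up M.+1; rewrite ltnNge => /negP; apply.
apply: leq_trans (leq_bigmax c) => /=.
by rewrite (big_rem m) //= leq_maxl.
Qed.

End Syzygies.

(** The terms of [u] are rewritten one at a time, so [u] may be inhomogeneous. *)
Lemma cone_writing (n : nat) (K : fieldType) p r (A : 'M[{mpoly K[n.+1]}]_(p, r)) h lev u :
  rewritable A h lev -> exists2 v, cone_vec h v & A *m u = A *m v.
Proof.
move=> /rewritable_choice [Q hQ].
by apply: (@cone_writing_aux _ _ _ _ A h lev Q) => k i /hQ [].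
Qed.

(** * The marked resolution *)

Section Resolution.
Variables (n : nat) (K : fieldType).
Notation R := {mpoly K[n.+1]}.

Record stage := Stage {
  st_tgt : nat;
  st_rk : nat;
  st_mx : 'M[R]_(st_tgt, st_rk);
  st_head : 'I_st_rk -> 'X_{1..n.+1};
  st_comp : 'I_st_rk -> 'I_st_tgt;
  st_lev : 'I_st_rk -> nat
}.

Definition good_stage (S : stage) : Prop :=
  rewritable (st_mx S) (@st_head S) (@st_lev S) /\
  cone_free (st_mx S) (@st_head S).

Definition rewriting_spec (S : stage)
    (Q : 'I_(st_rk S) -> 'I_n.+1 -> 'cV[R]_(st_rk S)) : Prop :=
  forall k i, nonmult (st_head k) i ->
    [/\ 'X_i *: col k (st_mx S) = st_mx S *m Q k i, cone_vec (@st_head S) (Q k i)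
      & homog_upto (@st_lev S) (st_lev k).+1 (st_lev k) (Q k i)].

Definition rewriting (S : stage) := epsilon (inhabits (fun _ _ => 0)) (@rewriting_spec S).

Lemma rewritingP (S : stage) : good_stage S -> rewriting_spec (@rewriting S).
Proof. by move=> [/rewritable_choice h _]; apply: epsilon_spec. Qed.

(** The target rank is the source rank of [S] by computation, so that the stages
    fit together to a complex without casts. *)
Definition next_stage (S : stage) : stage :=
  @Stage (st_rk S) #|syz_index (@st_head S)|
    (@syz_mx _ _ _ (@st_head S) (@rewriting S))
    (@syz_head _ _ (@st_head S)) (@syz_comp _ _ (@st_head S))
    (@syz_lev _ _ (@st_head S) (@st_lev S)).

Lemma next_stage_good S : good_stage S -> good_stage (next_stage S).
Proof.
move=> gS; have spec := rewritingP gS; case: (gS) => _ fS.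
split.
  by apply: (@syz_rewritable _ _ _ _ (st_mx S)) => // k i /spec [].
by apply: (@syz_free _ _ _ _ (@st_lev S)) => // k i /spec [].
Qed.

(** The rewriting rules of the marked elements alone determine the whole
    resolution; minimality is the bound on the levels carried by [rewritable]. *)
Lemma marked_resolution_exists (P : seq 'X_{1..n.+1}) (F : 'X_{1..n.+1} -> R) :
  uniq P ->
  let h := fun k : 'I_(size P) => nth 0%MM P k in
  let A := \row_k F (h k) in
  rewritable A h (fun k => mdeg (h k)) -> cone_free A h ->
  exists C : complex n K, marked_resolution P F C /\ minimal C.
Proof.
move=> uP h A rA fA.
pose S0 := @Stage 1 (size P) A h (fun _ => ord0) (fun k => mdeg (h k)).
pose st t := iter t next_stage S0.
have good t : good_stage (st t).
  by elim: t => [|t IH] //=; apply: next_stage_good.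
pose rk t := st_rk (st t).
pose dif t : 'M[R]_(tgt_rk rk t, rk t) :=
  match t with 0 => st_mx (st 0) | s.+1 => st_mx (st s.+1) end.
pose hd t : 'I_(rk t) -> 'X_{1..n.+1} * 'I_(tgt_rk rk t) :=
  match t with
  | 0 => fun k => (st_head (s := st 0) k, st_comp (s := st 0) k)
  | s.+1 => fun k => (st_head (s := st s.+1) k, st_comp (s := st s.+1) k)
  end.
have hd1 t k : (hd t k).1 = st_head (s := st t) k by case: t k.
exists (@Complex n K rk (fun t k => st_lev (s := st t) k + t)%N dif); split.
  exists hd; split.
  - split=> [[|t] k k' E|[|t] k /=].
    + have eh : nth 0%MM P k = nth 0%MM P k' := congr1 fst E.
      by apply/val_inj/eqP; rewrite -(nth_uniq 0%MM _ _ uP) ?ltn_ord ?eh.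
    + have eh := congr1 fst E; have ec := congr1 snd E.
      by apply: syz_inj => //; apply/eqP; rewrite -eq_mnm1; apply/eqP.
    + by [].
    + by rewrite /syz_head mdeg1 [RHS]add1n addnS; case: (t) k.
  - move=> m; split=> [mP|[k <-]].
      by have := nth_index 0%MM mP; rewrite -index_mem in mP; exists (Ordinal mP).
    exact: mem_nth.
  - by move=> k; rewrite /= mxE.
  - move=> t m k /=; rewrite hd1; split.
      move=> [l [<- <-]]; exists (syz_var l) => //; exact: syz_nonmult.
    by move=> [i hi ->]; have [c ck ci] := syz_exists hi; exists c; rewrite /syz_head ci ck.
  - move=> t l i k E /=.
    have ei : U_(syz_var l)%MM = U_(i)%MM := congr1 fst E.
    have ek : syz_comp l = k := congr1 snd E.
    have {ei} li : syz_var l = i by apply/eqP; rewrite -eq_mnm1 ei.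
    clear E.
    have ki : nonmult (st_head k) i by rewrite -li -ek; apply: syz_nonmult.
    have [Q1 Q2 Q3] := rewritingP (good t) ki.
    exists (rewriting k i); split.
    + by clear -Q1; case: t k Q1.
    + move=> a m ma; exists m; split=> // j; rewrite hd1; exact: Q2 ma j.
    + by rewrite col_syz_mx /syz_vec ek li.
move=> t l c a /=; rewrite mxE /syz_vec => E; apply/eqP/negPn/negP => a0.
have ki := syz_nonmult c.
have [_ _ Q3] := rewritingP (good t) ki.
have : 0%MM \in msupp (a%:MP : R) by rewrite msuppC (negbTE a0) inE.
have : homog_upto (@st_lev (st t)) (st_lev (syz_comp c)).+1 (st_lev (syz_comp c))
         ('X_(syz_var c) *: delta_mx (syz_comp c) ord0
            - rewriting (syz_comp c) (syz_var c)).
  apply: homog_uptoD; last exact: homog_uptoN.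
  by apply: homog_upto_delta => //; rewrite mdeg1.
move=> /(_ l 0%MM); rewrite E => hh /hh [].
by rewrite mdeg0 add0n => -> ; rewrite ltnn.
Qed.

End Resolution.

(** * The ideal of the first variables *)

Section LowVariables.
Variables (n : nat) (R : comNzRingType).
Implicit Types (f g : {mpoly R[n]}) (k : nat).

(** Membership in the ideal (x_0, ..., x_{k-1}), read off from the terms. *)
Definition low k f : Prop := supported (fun m => exists2 l : 'I_n, (l < k)%N & m l != 0%N) f.

Definition lowv k p q (u : 'M[{mpoly R[n]}]_(p, q)) : Prop :=
  forall i j, low k (u i j).

Lemma lowM k f g : low k g -> low k (f * g).
Proof.
move=> lg; apply: (supportedM (S := fun _ => True)); last exact: lg; last by [].
by move=> m m' _ [l lk ml]; exists l => //; rewrite mnmDE addn_eq0 negb_and ml orbT.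
Qed.

Lemma low0E f : low 0 f -> f = 0.
Proof.
move=> h; apply: msuppnil0; case E: (msupp f) => [//|m s].
by have [|] := h m; rewrite ?E ?mem_head.
Qed.

Lemma low_mono k k' f : (k <= k')%N -> low k f -> low k' f.
Proof. by move=> kk'; apply: supportedS => m [l lk ml]; exists l => //; apply: leq_trans kk'. Qed.

Lemma lowvD k p q (u v : 'M_(p, q)) : lowv k u -> lowv k v -> lowv k (u + v).
Proof. by move=> lu lv i j; rewrite mxE; apply: supportedD (lu i j) (lv i j). Qed.

Lemma lowvN k p q (u : 'M_(p, q)) : lowv k u -> lowv k (- u).
Proof. by move=> lu i j; rewrite mxE; apply: supportedN (lu i j). Qed.

Lemma lowvB k p q (u v : 'M_(p, q)) : lowv k u -> lowv k v -> lowv k (u - v).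
Proof. by move=> lu lv; apply: lowvD lu (lowvN lv). Qed.

Lemma lowvZ k p q f (u : 'M_(p, q)) : lowv k u -> lowv k (f *: u).
Proof. by move=> lu i j; rewrite mxE; apply: lowM (lu i j). Qed.

Lemma lowvM k p q r (A : 'M_(p, q)) (u : 'M_(q, r)) : lowv k u -> lowv k (A *m u).
Proof. by move=> lu i j; rewrite mxE; apply: supported_sum => l _; apply: lowM. Qed.

Lemma lowv_mono k k' p q (u : 'M_(p, q)) : (k <= k')%N -> lowv k u -> lowv k' u.
Proof. by move=> kk' lu i j; apply: low_mono (lu i j). Qed.

Lemma lowv0 k p q : lowv k (0 : 'M_(p, q)).
Proof. by move=> i j; rewrite mxE; apply: supported0. Qed.

Lemma lowv_trans k p q (v u w : 'M_(p, q)) :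
  lowv k (u - v) -> lowv k (v - w) -> lowv k (u - w).
Proof. by move=> uv vw; have := lowvD uv vw; rewrite addrA subrK. Qed.

Lemma lowXk (k : 'I_n) f : low k.+1 ('X_k * f).
Proof.
rewrite mulrC; apply: lowM; apply: supportedX; exists k => //.
by rewrite mnm1E eqxx.
Qed.

Definition xquo (k : 'I_n) f : {mpoly R[n]} :=
  \sum_(m <- msupp f | m k != 0%N) f@_m *: 'X_[m - U_(k)].

Lemma xquoE (k : 'I_n) f :
  f - 'X_k * xquo k f = \sum_(m <- msupp f | m k == 0%N) f@_m *: 'X_[m].
Proof.
rewrite {1}[f]mpolyE (bigID (fun m : 'X_{1..n} => m k == 0%N)) /=.
rewrite mulr_sumr -addrA -[RHS]addr0; congr (_ + _); apply/eqP.
rewrite subr_eq0; apply/eqP; apply: eq_bigr => m mk.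
by rewrite -scalerAr -mpolyXD addmC submK // lep1mP.
Qed.

Lemma mcoeff_xquo (k : 'I_n) f m : (xquo k f)@_m = f@_(m + U_(k)).
Proof.
apply/esym/eqP; rewrite -subr_eq0 addmC -[X in _ - X](mcoeffMX _ U_(k)) -mcoeffB.
rewrite mulrC xquoE mcoeff_eq0; apply/negP => hm.
suff : supported (fun m' : 'X_{1..n} => m' k = 0%N)
         (\sum_(m <- msupp f | m k == 0%N) f@_m *: 'X_[m]).
  by move/(_ _ hm); rewrite mnmDE mnm1E eqxx.
by apply: supported_sum => m' /eqP mk; apply: supportedZ; apply: supportedX.
Qed.

Lemma low_split (k : 'I_n) f : low k.+1 f -> low k (f - 'X_k * xquo k f).
Proof.
move=> lf; rewrite xquoE big_seq_cond; apply: supported_sum => m /andP [mf mk].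
apply: supportedZ; apply: supportedX; have [l lk ml] := lf m mf; exists l => //.
rewrite ltn_neqAle -ltnS lk andbT; apply: contraNneq ml => lk'.
by have -> : l = k by apply: val_inj.
Qed.

Lemma low_cancel (k : 'I_n) f : low k ('X_k * f) -> low k f.
Proof.
move=> lf m mf; have [|l lk] := lf (m + U_(k))%MM.
  by rewrite mcoeff_msupp mulrC addmC mcoeffMX -mcoeff_msupp.
rewrite mnmDE mnm1E -val_eqE /= (gtn_eqF lk) addn0 => ml; by exists l.
Qed.

Lemma lowv_split (k : 'I_n) p q (u : 'M_(p, q)) :
  lowv k.+1 u -> exists v, lowv k (u - 'X_k *: v).
Proof.
by move=> lu; exists (map_mx (xquo k) u) => i j; rewrite !mxE; apply: low_split.
Qed.

Lemma lowv_cancel (k : 'I_n) p q (u : 'M_(p, q)) : lowv k ('X_k *: u) -> lowv k u.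
Proof. by move=> lu i j; apply: low_cancel; have := lu i j; rewrite mxE. Qed.

Lemma lowv_Xk (k : 'I_n) p q (u : 'M_(p, q)) : lowv k.+1 ('X_k *: u).
Proof. by move=> i j; rewrite mxE; apply: lowXk. Qed.

End LowVariables.
Arguments lowv_Xk {n R} k {p q} u.

(** * Cancellation in linear complexes *)

Section LinearComplexes.
Variables (n : nat) (K : fieldType).
Notation R := {mpoly K[n.+1]}.
Variables (rk : nat -> nat) (D : forall t, 'M[R]_(tgt_rk rk t, rk t)) (d : nat).

(** The degrees of the entries of the linear resolution of an ideal generated in
    degree [d]. *)
Definition deg_of t : nat := if t is 0 then d else 1.

Hypothesis D_homog : forall t i j, D t i j \is (deg_of t).-homog.
Hypothesis D_cplx : forall t, D t *m D t.+1 = 0.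
Hypothesis D_exact : forall t (u : 'cV[R]_(rk t)), D t *m u = 0 ->
  exists v : 'cV[R]_(rk t.+1), u = D t.+1 *m v.

(** The elements of the cokernel of [D t] modulo (x_0, ..., x_{k-1}) which x_k
    annihilates are torsion with respect to x_j. *)
Definition torsion_at t (k j : 'I_n.+1) : Prop := forall w : 'cV[R]_(tgt_rk rk t),
  (exists u : 'cV[R]_(rk t), lowv k ('X_k *: w - D t *m u)) ->
  exists N, exists v : 'cV[R]_(rk t), lowv k ('X_j ^+ N *: w - D t *m v).

(** The homology at the source of [D t], modulo (x_0, ..., x_{k-1}), is torsion
    with respect to x_j. *)
Definition torsion_cycles t k (j : 'I_n.+1) : Prop := forall u : 'cV[R]_(rk t),
  lowv k (D t *m u) ->
  exists N, exists v : 'cV[R]_(rk t.+1), lowv k ('X_j ^+ N *: u - D t.+1 *m v).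

Hypothesis tors : forall k j, torsion_at 0 k j.

(** A class of coker(D_{t+1}) annihilated by x_k consists of cycles, because x_k
    is a nonzerodivisor modulo the smaller variables. *)
Lemma torsion_at_succ t (k j : 'I_n.+1) : torsion_cycles t k j -> torsion_at t.+1 k j.
Proof.
move=> T w [u lu]; apply: T; apply: lowv_cancel.
have := lowvM (A := D t) lu; rewrite mulmxBr mulmxA D_cplx mul0mx subr0.
by rewrite -scalemxAr.
Qed.

(** Long exact sequence of the multiplication by x_k: a cycle modulo
    (x_0, ..., x_k) has as its boundary modulo (x_0, ..., x_{k-1}) the x_k-multiple of
    an element of the cokernel annihilated by x_k, which is torsion. *)
Lemma torsion_cyclesP k t j : (k <= n.+1)%N -> torsion_cycles t k j.
Proof.
elim: k t => [|k IH] t lekn u lu.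
  have /D_exact [v ->] : D t *m u = 0.
    by apply/matrixP => a b; rewrite [RHS]mxE; apply/low0E/lu.
  by exists 0, v; rewrite expr0 scale1r subrr; apply: lowv0.
pose k' := Ordinal lekn; rewrite -[k.+1]/(k'.+1) in lu *.
have X : torsion_at t k' j.
  by case: (t) => [|s]; [apply: tors | apply/torsion_at_succ/IH/ltnW].
have [w lw] := lowv_split lu.
have [|N [v lv]] := X w.
  by exists u; have := lowvN lw; rewrite opprB.
(* x_j^N u - x_k v is a cycle modulo the variables before x_k. *)
have [|M [z lz]] := IH t (ltnW lekn) ('X_j ^+ N *: u - 'X_k' *: v).
  rewrite mulmxBr -!scalemxAr.
  have h1 := lowvZ (f := 'X_j ^+ N) lw; have h2 := lowvZ (f := 'X_k') lv.
  have := lowvD h1 h2; rewrite !scalerBr !scalerA ['X_k' * _]mulrC.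
  by rewrite addrA subrK.
exists (M + N)%N, z.
have := lowvD (lowv_mono (leqnSn k') lz) (lowv_Xk k' ('X_j ^+ M *: v)).
rewrite scalerBr !scalerA -exprD ['X_k' * _]mulrC addrAC.
by rewrite subrK.
Qed.

Definition no_constants r (u : 'cV[R]_r) : Prop := forall i, (u i ord0)@_0%MM = 0.

(** The homology modulo (x_0, ..., x_{k-1}) vanishes above the lowest strand.
    The basis of the source lies in that strand, so its vectors are the constant
    ones. *)
Definition acyclic_above t k : Prop := forall u : 'cV[R]_(rk t),
  no_constants u -> lowv k (D t *m u) ->
  exists v : 'cV[R]_(rk t.+1), lowv k (u - D t.+1 *m v).

Definition const_part r (v : 'cV[R]_r) : 'cV[R]_r := \col_i ((v i ord0)@_0%MM)%:MP.

Lemma homog_const_part p q e (A : 'M[R]_(p, q)) (v : 'cV[R]_q) i :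
  (forall i j, A i j \is e.-homog) -> (A *m const_part v) i ord0 \is e.-homog.
Proof.
move=> hA; rewrite mxE; apply: rpred_sum => l _; rewrite mxE mulrC mul_mpolyC.
exact: dhomogZ.
Qed.

Lemma mcoeff_const_part p q e (A : 'M[R]_(p, q)) (v : 'cV[R]_q) i m :
  (forall i j, A i j \is e.-homog) -> mdeg m = e ->
  ((A *m const_part v) i ord0)@_m = ((A *m v) i ord0)@_m.
Proof.
move=> hA dm; rewrite -{2}(subrK (const_part v) v) addrC mulmxDr [in RHS]mxE mcoeffD.
rewrite -[LHS]addr0; congr (_ + _).
apply/esym/eqP; rewrite mcoeff_eq0; apply/negP; rewrite mxE => hm.
suff : supported (fun m => (e < mdeg m)%N) (\sum_l A i l * (v - const_part v) l ord0).
  by move/(_ m hm); rewrite dm ltnn.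
apply: supported_sum => l _.
apply: (supportedM (S := fun m => mdeg m = e) (T := fun m => m != 0%MM)).
- move=> a b <- b0; rewrite mdegD -[X in (X < _)%N]addn0 ltn_add2l lt0n.
  by rewrite mdeg_eq0.
- by apply/homog_supported.
- move=> b hb; apply: contraTneq hb => ->.
  by rewrite mcoeff_msupp !mxE mcoeffB mcoeffC eqxx mulr1 subrr eqxx.
Qed.

(** The constants of [v] contribute to [A *m v] exactly the part of degree [e],
    which [w] does not have. *)
Lemma drop_constants k p q e (A : 'M[R]_(p, q)) (w : 'cV[R]_p) (v : 'cV[R]_q) :
  (forall i j, A i j \is e.-homog) ->
  (forall i m, mdeg m = e -> (w i ord0)@_m = 0) ->
  lowv k (w - A *m v) ->
  exists2 v', no_constants v' & lowv k (w - A *m v').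
Proof.
move=> hA hw lv; exists (v - const_part v) => [i|].
  by rewrite !mxE mcoeffB mcoeffC eqxx mulr1 subrr.
rewrite mulmxBr opprB addrCA addrC; apply: lowvD => // i j; rewrite (ord1 j) => m ml.
have dm : mdeg m = e by have /homog_supported h := homog_const_part v i hA; apply: h.
apply: (lv i ord0); move: ml.
rewrite !mcoeff_msupp (mcoeff_const_part _ _ hA dm) mxBE mcoeffB.
by rewrite (hw _ _ dm) sub0r oppr_eq0.
Qed.

Lemma take_constants k p q e (A : 'M[R]_(p, q)) (w : 'cV[R]_p) (v : 'cV[R]_q) :
  (forall i j, A i j \is e.-homog) -> (forall i, w i ord0 \is e.-homog) ->
  lowv k (w - A *m v) -> lowv k (w - A *m const_part v).
Proof.
move=> hA hw lv i j; rewrite (ord1 j) => m ml.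
have dm : mdeg m = e.
  have /homog_supported h : (w - A *m const_part v) i ord0 \is e.-homog.
    by rewrite mxBE; apply: rpredB; [apply: hw | apply: homog_const_part].
  exact: h.
apply: (lv i ord0); move: ml; rewrite !mcoeff_msupp !mxBE !mcoeffB.
by rewrite (mcoeff_const_part _ _ hA dm).
Qed.

(** x_k acts injectively, modulo (x_0, ..., x_{k-1}), on the cokernel of [D t] above
    the lowest strand: if x_k w is the image of [v], then [v] is a cycle modulo
    (x_0, ..., x_k), hence a boundary up to a multiple x_k y, and w is the image
    of y. *)
Lemma divide_variable t (k : 'I_n.+1) (w : 'cV[R]_(tgt_rk rk t)) (v : 'cV[R]_(rk t)) :
  acyclic_above t k.+1 ->
  (forall i m, (mdeg m).+1 = deg_of t -> (w i ord0)@_m = 0) ->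
  lowv k ('X_k *: w - D t *m v) ->
  exists y : 'cV[R]_(rk t), lowv k (w - D t *m y).
Proof.
move=> B hw lv; have [|v' v'0 lv'] := drop_constants (@D_homog t) _ lv.
  move=> i m dm; rewrite mxE; apply/eqP; rewrite mcoeff_eq0; apply/negP.
  move=> /msuppM_le /allpairsP [[a b] /= [/mem_msuppXP <- bw E]].
  move: bw; rewrite mcoeff_msupp hw ?eqxx //.
  by rewrite -dm E mdegD mdeg1.
have [|z lz] := B v' v'0.
  have := lowvB (lowv_Xk k w) (lowv_mono (leqnSn k) lv').
  by rewrite opprB addrCA subrr addr0.
have [y ly] := lowv_split lz; exists y; apply: lowv_cancel.
rewrite scalerBr; apply: lowv_trans lv' _.
have := lowvM (A := D t) ly; rewrite !mulmxBr mulmxA D_cplx mul0mx subr0.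
by rewrite -scalemxAr.
Qed.

(** Descending induction on k.  Modulo all the variables only constants survive.
    In general a power of x_k annihilates a given class, and [divide_variable]
    removes the factors x_k one by one. *)
Lemma acyclic_aboveP k t : (k <= n.+1)%N -> acyclic_above t k.
Proof.
move=> lekn; rewrite -[k](subKn lekn); move: (n.+1 - k)%N (leq_subr k n.+1) => a {k lekn}.
elim: a t => [|a IH] t lean.
  move=> u u0 _; exists 0; rewrite mulmx0 subr0 subn0 => i j m; rewrite (ord1 j) => mu.
  have /max_var [l ml _] : m != 0%MM.
    by apply: contraTneq mu => ->; rewrite mcoeff_msupp u0 eqxx.
  by exists l.
have lekn : (n.+1 - a.+1 < n.+1)%N by rewrite ltn_subrL.
pose k := Ordinal lekn; rewrite -[(n.+1 - a.+1)%N]/(val k).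
have kS : k.+1 = (n.+1 - a)%N by rewrite /= subnSK.
move=> u u0 lu; have [N [v lv]] := torsion_cyclesP k (ltnW lekn) lu.
elim: N v lv => [|N IHN] v lv; first by exists v; rewrite expr0 scale1r in lv.
have := @divide_variable t.+1 k ('X_k ^+ N *: u) v; rewrite kS.
case=> [|i m [] /eqP||y ly].
- by apply: IH; apply: ltnW.
- rewrite mdeg_eq0 => /eqP ->; rewrite mxE mcoeffM big1 // => -[a1 a2] /= /eqP E.
  have [-> ->] : bmnm a1 = 0%MM /\ bmnm a2 = 0%MM.
    by move/esym/eqP: E; rewrite mnmD_eq0 => /andP [/eqP -> /eqP ->].
  by rewrite u0 mulr0.
- by rewrite scalerA -exprS.
- exact: IHN ly.
Qed.

Lemma linear_cancel (k : 'I_n.+1) (a : 'cV[R]_(tgt_rk rk 0)) (v : 'cV[R]_(rk 0)) :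
  (forall i m, (mdeg m).+1 = d -> (a i ord0)@_m = 0) ->
  lowv k ('X_k *: a - D 0 *m v) ->
  exists y : 'cV[R]_(rk 0), lowv k (a - D 0 *m y).
Proof. by move=> ha; apply: (divide_variable (t := 0)) => //; apply: acyclic_aboveP. Qed.

End LinearComplexes.

(** * Dickson's lemma *)

Section MonomialOrder.
Variable n : nat.
Implicit Types m : 'X_{1..n}.

(** Inside one degree the order on terms is lexicographic with x_0 as most
    significant variable. *)
Lemma low_lt k m m' (l : 'I_n) : mdeg m = mdeg m' ->
  (forall i : 'I_n, (i < k)%N -> m i = 0%N) -> (l < k)%N -> m' l != 0%N -> (m < m')%O.
Proof.
move=> dm m0 lk m'l; apply/(ltmcP dm).
case: (@arg_minnP _ l (fun i => m' i != 0%N) (fun i => val i) m'l) => i m'i imin.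
have ik : (i < k)%N by apply: leq_ltn_trans lk; apply: imin.
exists i; last by rewrite m0 // lt0n.
move=> j ji; rewrite m0; last exact: ltn_trans ji ik.
by apply/esym/eqP; apply: contraTT ji => m'j; rewrite -leqNgt; apply: imin.
Qed.

Lemma le_low m m' (k : 'I_n) : mdeg m = mdeg m' -> (m <= m')%O -> m k != 0%N ->
  exists2 l : 'I_n, (l < k.+1)%N & m' l != 0%N.
Proof.
move=> dm le_mm' mk; apply: NNPP => no.
have : (m' < m)%O.
  apply: (@low_lt k.+1 _ _ k) => // i ik; apply/eqP/negPn/negP => m'i.
  by apply: no; exists i.
by rewrite ltNge le_mm'.
Qed.

(** Induction on the number [k] of exponents that are compared.  With [B] the
    largest exponent of x_k in a finite system for the first k exponents, only
    the finitely many values below [B] of that exponent need further systems. *)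
Lemma dickson_coord (k : nat) (S : 'X_{1..n} -> Prop) :
  exists s : seq 'X_{1..n}, (forall m, m \in s -> S m) /\
    forall m, S m -> exists2 t, t \in s & forall i : 'I_n, (i < k)%N -> (t i <= m i)%N.
Proof.
elim: k S => [|k IH] S.
  have [[m Sm]|no] := classic (exists m, S m).
    by exists [:: m]; split=> [m'|m' _]; [rewrite inE => /eqP -> | exists m; rewrite ?mem_head].
  by exists [::]; split=> // m Sm; case: no; exists m.
case: (ltnP k n) => [kn|nk]; last first.
  have [s [h1 h2]] := IH S; exists s; split=> // m /h2 [t ts tm]; exists t => // i _.
  by apply: tm; apply: leq_trans (ltn_ord i) nk.
pose k' := Ordinal kn; have [s0 [s0S dom0]] := IH S.
(* Terms whose exponent of x_k is at least B are already covered by s0. *)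
pose B := \max_(t <- s0) t k'.
have [s1 [s1S dom1]] : exists s : seq 'X_{1..n}, (forall m, m \in s -> S m) /\
    forall m, S m -> (m k' < B)%N ->
      exists2 t, t \in s & forall i : 'I_n, (i < k.+1)%N -> (t i <= m i)%N.
  elim: B => [|b [s [sS dom]]]; first by exists [::].
  have [s' [s'S dom']] := IH (fun m => S m /\ m k' = b).
  exists (s ++ s'); split=> [m|m Sm].
    by rewrite mem_cat => /orP [/sS|/s'S []].
  rewrite ltnS leq_eqVlt => /orP [/eqP mb|lt].
    have [t ts tm] := dom' m (conj Sm mb); exists t; first by rewrite mem_cat ts orbT.
    move=> i; rewrite ltnS leq_eqVlt => /orP [/eqP ik|]; last exact: tm.
    have -> : i = k' by apply: val_inj.
    by have [_ ->] := s'S t ts; rewrite mb.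
  by have [t ts tm] := dom m Sm lt; exists t => //; rewrite mem_cat ts.
exists (s0 ++ s1); split=> [m|m Sm].
  by rewrite mem_cat => /orP [/s0S|/s1S].
case: (ltnP (m k') B) => [lt|ge].
  by have [t ts tm] := dom1 m Sm lt; exists t => //; rewrite mem_cat ts orbT.
have [t ts tm] := dom0 m Sm; exists t; first by rewrite mem_cat ts.
move=> i; rewrite ltnS leq_eqVlt => /orP [/eqP ik|]; last exact: tm.
have -> : i = k' by apply: val_inj.
by apply: leq_trans ge; rewrite /B (big_rem t) //= leq_maxl.
Qed.

(** The elements that are minimal in a finite system of divisors are minimal in
    the whole of [S]. *)
Lemma dickson (S : 'X_{1..n} -> Prop) :
  exists P : seq 'X_{1..n}, [/\ uniq P,
    (forall m, m \in P <-> S m /\ forall m', S m' -> (m' <= m)%MM -> m' = m)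
    & forall m, S m -> exists2 t, t \in P & (t <= m)%MM].
Proof.
have [s [sS dom]] := dickson_coord n S.
have {}dom m : S m -> exists2 t, t \in s & (t <= m)%MM.
  by move=> /dom [t ts tm]; exists t => //; apply/mnm_lepP => i; apply: tm.
have anti (a b : 'X_{1..n}) : (a <= b)%MM -> (b <= a)%MM -> a = b.
  move=> /mnm_lepP ab /mnm_lepP ba; apply/mnmP => i; apply/eqP.
  by rewrite eqn_leq ab ba.
pose P := undup [seq t <- s | all (fun t' => (t' <= t)%MM ==> (t' == t)) s].
have PE t : t \in P <-> t \in s /\ forall t', t' \in s -> (t' <= t)%MM -> t' = t.
  rewrite mem_undup mem_filter; split=> [/andP [/allP h ts]|[ts h]].
    by split=> // t' /h /implyP h' /h' /eqP.
  by rewrite ts andbT; apply/allP => t' t's; apply/implyP => /(h _ t's) ->.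
exists P; split; first exact: undup_uniq.
- move=> m; rewrite PE; split=> [[ms min]|[Sm min]]; split; try exact: sS.
  + move=> m' /dom [t ts tm'] m'm; have tm := min t ts (lepm_trans tm' m'm).
    by apply: anti m'm _; rewrite -tm.
  + by have [t ts tm] := dom m Sm; rewrite -(min t (sS _ ts) tm).
  + by move=> t' /sS; apply: min.
- move=> m; move: {2}(mdeg m) (leqnn (mdeg m)) => N; elim/ltn_ind: N m => N IH m mN Sm.
  have [t ts tm] := dom m Sm; have [tP|ntP] := boolP (t \in P); first by exists t.
  have [t' [t's t't ne]] : exists t', [/\ t' \in s, (t' <= t)%MM & t' <> t].
    apply: NNPP => no; move/negP: ntP; apply; apply/PE; split=> // t' t's t't.
    by apply: NNPP => ne; apply: no; exists t'.
  have lt : (mdeg t' < mdeg m)%N.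
    apply: (@leq_trans (mdeg t)); last first.
      by rewrite -(submK tm) mdegD leq_addl.
    rewrite -(submK t't) mdegD -[X in (X < _)%N]add0n ltn_add2r lt0n mdeg_eq0.
    by apply/eqP => E; apply: ne; rewrite -[RHS](submK t't) E add0m.
  have [t'' t''P t''t'] := IH _ (leq_trans lt mN) t' (leqnn _) (sS _ t's).
  by exists t'' => //; apply: lepm_trans t''t' (lepm_trans t't tm).
Qed.

End MonomialOrder.

(** * Stable sets of terms *)

Section StableSets.
Variable n : nat.
Implicit Types m t : 'X_{1..n.+1}.

Definition up_closed (S : 'X_{1..n.+1} -> Prop) : Prop :=
  forall m i, S m -> S (m + U_(i))%MM.

Definition stable_set (S : 'X_{1..n.+1} -> Prop) : Prop :=
  forall m (k i : 'I_n.+1), (forall l : 'I_n.+1, (l < k)%N -> m l = 0%N) ->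
    (k < i)%N -> S (m + U_(k))%MM -> S (m + U_(i))%MM.

Lemma up_closed_add S m m' : up_closed S -> S m -> S (m + m')%MM.
Proof.
move=> up; move: {2}(mdeg m') (erefl (mdeg m')) => N; elim: N m' => [|N IH] m' dm Sm.
  by move/eqP: dm; rewrite mdeg_eq0 => /eqP ->; rewrite addm0.
have /max_var [i mi _] : m' != 0%MM by rewrite -mdeg_eq0 dm.
have [a Ea] := mnmU_split mi; subst m'; rewrite addmA; apply: up; apply: IH => //.
by move: dm; rewrite mdegD mdeg1 addn1 => -[].
Qed.

Lemma up_closed_le S m m' : up_closed S -> S m -> (m <= m')%MM -> S m'.
Proof. by move=> up Sm mm'; rewrite -(submK mm') addmC; apply: up_closed_add. Qed.

Lemma min_var m : m != 0%MM ->
  exists2 k : 'I_n.+1, m k != 0%N & forall l : 'I_n.+1, (l < k)%N -> m l = 0%N.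
Proof.
move=> /max_var [i mi _].
case: (@arg_minnP _ i (fun i => m i != 0%N) (fun i => val i) mi) => k mk kmin.
exists k => // l lk; apply/eqP; apply: contraTT lk => ml.
by rewrite -leqNgt; apply: kmin.
Qed.

Section Pommaret.
Variables (S : 'X_{1..n.+1} -> Prop) (P : seq 'X_{1..n.+1}).
Hypotheses (S_up : up_closed S) (S_stable : stable_set S).
Hypothesis PE : forall m, m \in P <-> S m /\ forall m', S m' -> (m' <= m)%MM -> m' = m.

(** Eliahou and Kervaire: as long as a term of [S] is not a minimal generator,
    its smallest variable can be removed inside [S].  Some variable can be
    removed, and stability exchanges it for the smallest one. *)
Lemma stable_cone m : S m -> exists2 t, t \in P & in_cone t m.
Proof.
move: {2}(mdeg m) (erefl (mdeg m)) => N; elim: N m => [|N IH] m dm Sm.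
  move/eqP: dm; rewrite mdeg_eq0 => /eqP dm; subst m.
  exists 0%MM; last by exists 0%MM; split=> [|i _]; rewrite ?addm0 ?mnm0E.
  apply/PE; split=> // m' _ /mnm_lepP m'0; apply/mnmP => i; apply/eqP.
  by have := m'0 i; rewrite mnm0E leqn0.
have [mP|nmP] := boolP (m \in P).
  by exists m => //; exists 0%MM; split=> [|i _]; rewrite ?add0m ?mnm0E.
have [m' [Sm' m'm ne]] : exists m', [/\ S m', (m' <= m)%MM & m' <> m].
  apply: NNPP => no; move/negP: nmP; apply; apply/PE; split=> // m' Sm' m'm.
  by apply: NNPP => ne; apply: no; exists m'.
have [j m'j] : exists j, (m' j < m j)%N.
  apply: NNPP => no; apply: ne; apply/mnmP => j; apply/eqP; rewrite eqn_leq.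
  rewrite (mnm_lepP m'm) leqNgt; apply/negP => lt; apply: no; exists j.
  by [].
have mj : m j != 0%N by rewrite -lt0n (leq_ltn_trans _ m'j).
have [a Ea] := mnmU_split mj.
have Sa : S a.
  apply: up_closed_le Sm' _ => //; apply/mnm_lepP => i; have := mnm_lepP m'm i.
  rewrite Ea mnmDE mnm1E; case: eqP => [<-|_]; last by rewrite addn0.
  by move: m'j; rewrite Ea mnmDE mnm1E eqxx addn1 ltnS.
have [k mk kmin] : exists2 k : 'I_n.+1, m k != 0%N & forall l : 'I_n.+1, (l < k)%N -> m l = 0%N.
  by apply: min_var; rewrite -mdeg_eq0 dm.
have [b Eb] := mnmU_split mk.
have Sb : S b.
  have [kj|kj] := eqVneq k j.
    by suff -> : b = a by []; apply: (@addIm _ U_(k)%MM); rewrite -Eb kj.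
  have ak : a k != 0%N by move: mk; rewrite Ea mnmDE mnm1E [j == k]eq_sym (negbTE kj) addn0.
  have [c Ec] := mnmU_split ak.
  have -> : b = (c + U_(j))%MM.
    apply: (@addIm _ U_(k)%MM); rewrite -Eb Ea Ec -!addmA; congr (_ + _)%MM.
    exact: addmC.
  apply: (@S_stable c k j); last by rewrite -Ec.
    by move=> l /kmin /eqP; rewrite Ea Ec !mnmDE !addn_eq0 => /andP [/andP [/eqP]].
  rewrite ltn_neqAle; apply/andP; split; first by rewrite val_eqE.
  by rewrite leqNgt; apply/negP => /kmin mj0; rewrite mj0 eqxx in mj.
have [|t tP [d [Ed hd]]] := IH b _ Sb.
  by move: dm; rewrite Eb mdegD mdeg1 addn1 => -[].
exists t => //; exists (d + U_(k))%MM; split.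
  by rewrite Eb Ed -!addmA; congr (_ + _)%MM; apply: addmC.
move=> i ti; rewrite mnmDE hd // mnm1E; case: eqP => // ki; subst i.
have /nonmultP [l lk tl] := ti; have := kmin l lk.
by rewrite Eb Ed !mnmDE => /eqP; rewrite !addn_eq0 (negbTE tl) andbF.
Qed.

(** Two terms whose cones meet are comparable for divisibility: both agree with the
    common multiple in all variables above their own smallest one. *)
Lemma stable_cone_uniq t s m : t \in P -> s \in P ->
  in_cone t m -> in_cone s m -> t = s.
Proof.
move=> /PE [St tmin] /PE [Ss smin] [d [Ed hd]] [e [Ee he]].
have key a b (x y : 'X_{1..n.+1}) (i j : 'I_n.+1) : m = (a + x)%MM -> m = (b + y)%MM ->
    (forall i, nonmult x i -> a i = 0%N) -> (i < j)%N -> (y i < x i)%N -> (y j <= x j)%N.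
  move=> Ea Eb ha ij yi; have aj : a j = 0%N.
    by apply: ha; apply/nonmultP; exists i => //; rewrite -lt0n (leq_ltn_trans _ yi).
  have := congr1 (fun z : 'X_{1..n.+1} => z j) Ea; rewrite Eb !mnmDE aj add0n => <-.
  by rewrite leq_addl.
have [ts|nts] := boolP (t <= s)%MM; first exact: smin.
have [st|nst] := boolP (s <= t)%MM; first by apply/esym/tmin.
have wit (x y : 'X_{1..n.+1}) : ~~ (x <= y)%MM -> exists i, (y i < x i)%N.
  move=> /mnm_lepP no; apply: NNPP => no'; apply: no => i; rewrite leqNgt.
  by apply/negP => lt; apply: no'; exists i.
have [i si] := wit _ _ nts; have [j tj] := wit _ _ nst.
case: (ltngtP i j) => [ij|ji|/val_inj ij].
- by have := key _ _ _ _ _ _ Ed Ee hd ij si; rewrite leqNgt tj.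
- by have := key _ _ _ _ _ _ Ee Ed he ji tj; rewrite leqNgt si.
- by subst j; have := ltn_trans si tj; rewrite ltnn.
Qed.

Variable K : fieldType.
Notation R := {mpoly K[n.+1]}.

Lemma supported_ideal : is_ideal (supported S : R -> Prop).
Proof.
split; [exact: supported0 | by move=> f g; apply: supportedD |].
move=> a f Sf; apply: (supportedM (S := fun _ => True) _ _ Sf) => // m m' _ Sm'.
by rewrite addmC; apply: up_closed_add.
Qed.

Lemma supported_mono m : supported S ('X_[m] : R) <-> S m.
Proof.
split=> [h|]; last exact: supportedX.
by apply: h; rewrite msuppX inE.
Qed.

Lemma ideal_gen_mono (Q : seq 'X_{1..n.+1}) m :
  ideal_gen (monomials Q : R -> Prop) 'X_[m] -> exists2 t, t \in Q & (t <= m)%MM.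
Proof.
move=> [r [a [g [hg E]]]].
have : supported (fun m => exists2 t, t \in Q & (t <= m)%MM) ('X_[m] : R).
  rewrite E; apply: supported_sum => i _; have [t tQ ->] := hg i.
  apply: (supportedM (S := fun _ => True) (T := eq t)); [|by []|exact: supportedX].
  by move=> b c _ <-; exists t => //; apply: lem_addl.
by apply; rewrite msuppX inE.
Qed.

Lemma mono_generated (Q : seq 'X_{1..n.+1}) (f : R) :
  supported (fun m => exists2 t, t \in Q & (t <= m)%MM) f -> ideal_gen (monomials Q) f.
Proof.
move=> hf; pose s := msupp f.
have h i : exists t, t \in Q /\ (t <= nth 0%MM s (i : 'I_(size s)))%MM.
  by have [t tQ ti] := hf _ (mem_nth 0%MM (ltn_ord i)); exists t.
pose t i := epsilon (inhabits 0%MM) (fun t => t \in Q /\ (t <= nth 0%MM s (i : 'I_(size s)))%MM).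
have ht i : t i \in Q /\ (t i <= nth 0%MM s i)%MM by apply: epsilon_spec (h i).
exists (size s), (fun i : 'I_(size s) => f@_(nth 0%MM s i) *: 'X_[nth 0%MM s i - t i]), (fun i => 'X_[t i]).
split=> [i|]; first by exists (t i) => //; case: (ht i).
rewrite [LHS]mpolyE -/s (big_nth 0%MM) big_mkord; apply: eq_bigr => i _.
by rewrite -scalerAl -mpolyXD submK //; case: (ht i).
Qed.

Hypothesis P_uniq : uniq P.
Hypothesis P_gen : forall m, S m -> exists2 t, t \in P & (t <= m)%MM.

Lemma mono_generates : generates (monomials P) (supported S : R -> Prop).
Proof.
move=> f; split=> [Sf|[r [a [g [hg ->]]]]].
  by apply: mono_generated => m /Sf /P_gen.
have [_ _ id3] := supported_ideal; apply: supported_sum => i _; apply: id3.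
by have [t tP ->] := hg i; apply: supportedX; have /PE [] := tP.
Qed.

Lemma pommaret_basisP : pommaret_basis (supported S : R -> Prop) P.
Proof.
split=> //; [exact: mono_generates | move=> m | move=> t s m; exact: stable_cone_uniq].
rewrite supported_mono; split; first exact: stable_cone.
by move=> [t /PE [St _] [d [-> _]]]; rewrite addmC; apply: up_closed_add.
Qed.

Lemma stable_supported : stable (supported S : R -> Prop).
Proof.
split.
  by split=> [|f m Sf mf]; [apply: supported_ideal | apply: supportedX; apply: Sf].
exists P; split; first exact: pommaret_basisP.
split; first exact: mono_generates.
move=> Q QP gQ t tP; have /PE [St tmin] := tP.
have /gQ /ideal_gen_mono [q qQ qt] : supported S ('X_[t] : R) by apply: supportedX.
by rewrite -(tmin q) //; have /PE [] := QP _ qQ.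
Qed.

End Pommaret.
End StableSets.

(** * Leading terms *)

Section LeadIdeals.
Variables (n : nat) (K : fieldType).
Notation R := {mpoly K[n.+1]}.
Implicit Types (f g : R) (m t : 'X_{1..n.+1}).

Lemma mdeg_mlast d f : f \is d.-homog -> f != 0 -> mdeg (mlast f) = d.
Proof. by move=> /homog_supported hf f0; apply: hf; apply: mlast_supp. Qed.

Lemma homogX d m : mdeg m = d -> 'X_[K, m] \is d.-homog.
Proof. by move=> <-; rewrite dhomogX. Qed.

Lemma homogZX d c m : mdeg m = d -> c *: 'X_[K, m] \is d.-homog.
Proof. by move=> /homogX; apply: dhomogZ. Qed.

(** Descent on the leading term of a form; each degree has finitely many terms. *)
Lemma homog_lead_ind d (Q : R -> Prop) : Q 0 ->
  (forall f, f \is d.-homog -> f != 0 ->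
     (forall g, g \is d.-homog -> supported (fun m => (mlast f < m)%O) g -> Q g) -> Q f) ->
  forall f, f \is d.-homog -> Q f.
Proof.
move=> Q0 Qstep.
pose N f := #|[pred m : 'X_{1..n.+1 < d.+1} | (mlast f <= bmnm m)%O]|.
move=> f; move: {2}(N f) (leqnn (N f)) => a; elim/ltn_ind: a f => a IH f fa hf.
have [->//|f0] := eqVneq f 0; apply: Qstep => // g hg fg.
have [->//|g0] := eqVneq g 0; apply: (IH (N g)) => //; apply: leq_trans fa.
have fltg : (mlast f < mlast g)%O by apply: fg; apply: mlast_supp.
have df : (mdeg (mlast f) < d.+1)%N.
  by rewrite (mdeg_mlast hf).
apply: proper_card; apply/properP; split.
  by apply/subsetP => m; rewrite !inE; apply: le_trans; apply: ltW.
by exists (BMultinom df); rewrite !inE //= -ltNge.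
Qed.

(** The order on terms reverses the reverse lexicographic one inside a degree, so
    this makes [t] the leading term. *)
Definition marked_at t (F : R) : Prop :=
  [/\ F \is (mdeg t).-homog, F@_t = 1 & supported (fun m => (t < m)%O) (F - 'X_[t])].

Lemma marked_at_ge t F m : marked_at t F -> m \in msupp F -> m = t \/ (t < m)%O.
Proof.
move=> [_ _ h] mF; have [->|ne] := eqVneq m t; [by left | right; apply: h].
by rewrite mcoeff_msupp mcoeffB mcoeffX [t == m]eq_sym (negbTE ne) subr0 -mcoeff_msupp.
Qed.

Lemma subtract_lead d f t F m : f \is d.-homog -> f != 0 -> marked_at t F ->
  mlast f = (m + t)%MM ->
  let g := f - f@_(mlast f) *: ('X_[m] * F) in
  g \is d.-homog /\ supported (fun m => (mlast f < m)%O) g.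
Proof.
move=> hf f0 hF E g; have [homF F1 _] := hF.
have dE : (mdeg m + mdeg t)%N = d.
  by rewrite -mdegD -E; apply: mdeg_mlast.
split.
  by apply: rpredB => //; apply: dhomogZ; rewrite -dE; apply: dhomogM => //; rewrite dhomogX.
move=> m' m'g; rewrite lt_neqAle; apply/andP; split.
  apply: contraTneq m'g => <-; rewrite mcoeff_msupp mcoeffB mcoeffZ mulrC.
  by rewrite [in X in X * _]E [_ * F]mulrC mcoeffMX F1 mul1r subrr eqxx.
have := msuppB_le m'g; rewrite mem_cat => /orP [/mlast_lemc //|/msuppZ_le].
move=> /msuppM_le /allpairsP [[a b] /= [/mem_msuppXP <- bF ->]].
by rewrite E lemc_add2r; have [->|/ltW] := marked_at_ge hF bF.
Qed.

Definition lead_set (I : R -> Prop) m : Prop :=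
  exists f, [/\ I f, f \is (mdeg m).-homog, f != 0 & mlast f = m].

Lemma in_lead_set (I : R -> Prop) d f : I f -> f \is d.-homog -> f != 0 -> lead_set I (mlast f).
Proof. by move=> If hf f0; exists f; split=> //; rewrite (mdeg_mlast hf). Qed.

Section GradedIdeal.
Variable I : R -> Prop.
Hypothesis idealI : is_ideal I.

Lemma ideal0 : I 0. Proof. by case: idealI. Qed.
Lemma idealD f g : I f -> I g -> I (f + g). Proof. by case: idealI => _ h _; apply: h. Qed.
Lemma idealM f g : I g -> I (f * g). Proof. by case: idealI => _ _ h; apply: h. Qed.
Lemma idealZ c f : I f -> I (c *: f). Proof. by rewrite -mul_mpolyC; apply: idealM. Qed.
Lemma idealB f g : I f -> I g -> I (f - g).
Proof. by move=> If Ig; rewrite -scaleN1r; apply: idealD => //; apply: idealZ. Qed.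

Lemma lead_set_up : up_closed (lead_set I).
Proof.
move=> m i [f [If hf f0 fm]]; exists ('X_i * f); split.
- exact: idealM.
- by rewrite mdegD addnC; apply: dhomogM => //; rewrite dhomogX.
- by apply: mulf_neq0 => //; rewrite -msupp_eq0 msuppX.
- apply: mlastE => [|m' /msuppM_le /allpairsP [[a b] /= [/mem_msuppXP <- bf ->]]].
    by rewrite mcoeff_msupp mulrC addmC mcoeffMX -mcoeff_msupp -fm mlast_supp.
  by rewrite addmC lemc_add2r -fm mlast_lemc.
Qed.

Lemma lead_set_rep t : lead_set I t -> exists F, I F /\ marked_at t F.
Proof.
move=> [f [If hf f0 ft]]; have ft0 : f@_t != 0 by rewrite -mcoeff_msupp -ft mlast_supp.
exists ((f@_t)^-1 *: f); split; first exact: idealZ.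
split; [exact: dhomogZ | by rewrite mcoeffZ mulVf |].
move=> m mf; rewrite lt_neqAle; apply/andP; split.
  apply: contraTneq mf => <-.
  by rewrite mcoeff_msupp mcoeffB mcoeffZ mulVf // mcoeffX eqxx subrr eqxx.
have := msuppB_le mf; rewrite mem_cat => /orP [/msuppZ_le|/mem_msuppXP -> //].
by rewrite -ft; apply: mlast_lemc.
Qed.

Lemma normal_form d f : f \is d.-homog -> exists r,
  [/\ I (f - r), r \is d.-homog, supported (fun m => ~ lead_set I m) r
    & forall m0, supported (fun m => (m0 < m)%O) f -> supported (fun m => (m0 < m)%O) r].
Proof.
move: f; apply: homog_lead_ind.
  exists 0; split=> [|||m0 _]; rewrite ?subrr.
  - exact: ideal0.
  - exact: rpred0.
  - exact: supported0.
  - exact: supported0.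
move=> f hf f0 IH; have mf := mlast_supp f0.
have [St|nSt] := classic (lead_set I (mlast f)).
  have [F [IF hF]] := lead_set_rep St.
  have [hg sg] := subtract_lead hf f0 hF (esym (add0m _)).
  have [r [Ir hr nr br]] := IH _ hg sg; exists r; split=> //.
    rewrite addrAC in Ir; have := idealD Ir (idealZ f@_(mlast f) (idealM 'X_[0] IF)).
    by rewrite subrK.
  move=> m0 sf; apply: br => m /sg; apply: lt_trans; exact: sf.
pose g := f - f@_(mlast f) *: 'X_[mlast f].
have [|m mg|r [Ir hr nr br]] := IH g.
- by apply: rpredB => //; apply: homogZX; apply: mdeg_mlast.
- rewrite lt_neqAle; apply/andP; split.
    by apply: contraTneq mg => <-; rewrite mcoeff_msupp mcoeffB mcoeffZ mcoeffX eqxx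
      mulr1 subrr eqxx.
  have := msuppB_le mg; rewrite mem_cat => /orP [/mlast_lemc //|/msuppZ_le].
  by move=> /mem_msuppXP <-.
exists (r + f@_(mlast f) *: 'X_[mlast f]); split.
- by move: Ir; rewrite /g opprD addrA addrAC.
- by apply: rpredD => //; apply: homogZX; apply: mdeg_mlast.
- by apply: supportedD => //; apply: supportedZ; apply: supportedX.
- move=> m0 sf; apply: supportedD; last by apply: supportedZ; apply: supportedX; apply: sf.
  by apply: br; apply: supportedB => //; apply: supportedZ; apply: supportedX; apply: sf.
Qed.

Lemma reduced_rep t : lead_set I t -> exists F,
  [/\ I F, marked_at t F & supported (fun m => ~ lead_set I m) (F - 'X_[t])].
Proof.
move=> /lead_set_rep [F [IF [homF F1 sF]]].
have hX : F - 'X_[t] \is (mdeg t).-homog by apply: rpredB => //; rewrite dhomogX.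
have [r [Ir hr nr br]] := normal_form hX; exists ('X_[t] + r).
have Er : 'X_[t] + r - 'X_[t] = r by rewrite addrAC subrr add0r.
split.
- by rewrite -[_ + r](subKr F) [- ('X_[t] + r)]opprD addrA; apply: idealB.
- split; [by apply: rpredD => //; rewrite dhomogX| | by rewrite Er; apply: br].
  rewrite mcoeffD mcoeffX eqxx; apply/eqP; rewrite -subr_eq0 addrAC subrr add0r.
  by rewrite mcoeff_eq0; apply/negP => /(br _ sF); rewrite ltxx.
- by rewrite Er.
Qed.

End GradedIdeal.

Section MarkedRow.
Variables (P : seq 'X_{1..n.+1}) (F : 'X_{1..n.+1} -> R).
Definition hd_of (k : 'I_(size P)) : 'X_{1..n.+1} := nth 0%MM P k.
Definition lev_of (k : 'I_(size P)) : nat := mdeg (hd_of k).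
Definition marked_row : 'rV[R]_(size P) := \row_k F (hd_of k).

Hypothesis F_marked : forall t, t \in P -> marked_at t (F t).

Lemma hd_of_in k : hd_of k \in P. Proof. exact: mem_nth. Qed.

Lemma hd_of_ex t : t \in P -> exists k, hd_of k = t.
Proof.
move=> tP; have lt : (index t P < size P)%N by rewrite index_mem.
by exists (Ordinal lt); apply: nth_index.
Qed.

Lemma marked_row_delta k m :
  marked_row *m ('X_[m] *: delta_mx k ord0) = ('X_[m] * F (hd_of k))%:M.
Proof.
rewrite -scalemxAr -colE; apply/matrixP => i j.
by rewrite (ord1 i) (ord1 j) !mxE eqxx mulr1n.
Qed.

(** Reduction by the marked elements, whose leading terms are their marks. *)
Lemma division (S : 'X_{1..n.+1} -> Prop) d f :
  (forall m, S m -> exists2 t, t \in P & (t <= m)%MM) -> f \is d.-homog ->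
  exists (u : 'cV[R]_(size P)) (r : R), [/\ f = (marked_row *m u) ord0 ord0 + r, r \is d.-homog
    & supported (fun m => ~ S m) r].
Proof.
move=> dom; move: f; apply: homog_lead_ind.
  by exists 0, 0; split; [rewrite mulmx0 mxE addr0|exact: rpred0|exact: supported0].
move=> f hf f0 IH; have mf := mlast_supp f0.
have [St|nSt] := classic (S (mlast f)).
  have [t tP tm] := dom _ St; have [hg sg] := subtract_lead hf f0 (F_marked tP) (esym (submK tm)).
  have [u [r [E hr nr]]] := IH _ hg sg; have [k Ek] := hd_of_ex tP.
  exists (u + (f@_(mlast f))%:MP *: ('X_[mlast f - t] *: delta_mx k ord0)), r; split=> //.
  rewrite mulmxDr [in X in _ = X + _]mxE -scalemxAr marked_row_delta Ek addrAC -E.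
  by rewrite !mxE eqxx mulr1n mul_mpolyC subrK.
pose g := f - f@_(mlast f) *: 'X_[mlast f].
have homX : f@_(mlast f) *: 'X_[mlast f] \is d.-homog.
  by apply: homogZX; apply: mdeg_mlast.
have [|m mg|u [r [E hr nr]]] := IH g.
- exact: rpredB.
- rewrite lt_neqAle; apply/andP; split.
    by apply: contraTneq mg => <-; rewrite mcoeff_msupp mcoeffB mcoeffZ mcoeffX eqxx
      mulr1 subrr eqxx.
  have := msuppB_le mg; rewrite mem_cat => /orP [/mlast_lemc //|/msuppZ_le].
  by move=> /mem_msuppXP <-.
exists u, (r + f@_(mlast f) *: 'X_[mlast f]); split.
- by rewrite addrA -E subrK.
- exact: rpredD.
- by apply: supportedD => //; apply: supportedZ; apply: supportedX.
Qed.

Lemma marked_row_in (I : R -> Prop) (u : 'cV[R]_(size P)) :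
  is_ideal I -> (forall t, t \in P -> I (F t)) ->
  I ((marked_row *m u) ord0 ord0).
Proof.
move=> idI IF; rewrite mxE; apply: (big_ind I); first exact: ideal0.
  by move=> a b; apply: idealD.
by move=> k _; rewrite mulrC; apply: idealM => //; rewrite mxE; apply: IF; apply: hd_of_in.
Qed.

Lemma graded_generated (I : R -> Prop) d f : is_ideal I ->
  (forall t, t \in P -> I (F t)) ->
  (forall m, lead_set I m -> exists2 t, t \in P & (t <= m)%MM) ->
  I f -> f \is d.-homog -> exists u : 'cV[R]_(size P), f = (marked_row *m u) ord0 ord0.
Proof.
move=> idI IF dom If hf; have [u [r [E hr nr]]] := division dom hf.
have [r0|r0] := eqVneq r 0; first by exists u; rewrite E r0 addr0.
case: (nr (mlast r) (mlast_supp r0)); apply: in_lead_set hr r0.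
have -> : r = f - (marked_row *m u) ord0 ord0 by rewrite E addrC addKr.
by apply: idealB => //; apply: marked_row_in.
Qed.

Hypothesis P_uniq : uniq P.
Hypothesis cone_uniq : forall t s m, t \in P -> s \in P ->
  in_cone t m -> in_cone s m -> t = s.

(** Among the terms m t with m in the coefficient of the element marked on t, the
    leading one arises only once because the cones are disjoint, so it cannot
    cancel. *)
Lemma cone_lead (v : 'cV[R]_(size P)) : cone_vec hd_of v -> v != 0 ->
  exists k m, m \in msupp (v k ord0) /\
     (m + hd_of k)%MM \in msupp ((marked_row *m v) ord0 ord0).
Proof.
move=> cv v0; pose T mu := exists k m, m \in msupp (v k ord0) /\ mu = (m + hd_of k)%MM.
have [mu0 Tmu0] : exists mu, T mu.
  apply: NNPP => no; move/eqP: v0; apply; apply/matrixP => k j; rewrite (ord1 j) mxE.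
  apply/eqP/negPn/negP => vk; apply: no; exists (mlast (v k ord0) + hd_of k)%MM, k, (mlast (v k ord0)).
  by split=> //; apply: mlast_supp.
have [mu [Tmu mumin]] : exists mu, T mu /\ forall mu', T mu' -> (mu <= mu')%O.
  move: mu0 Tmu0; apply: ltmwf => mu IH Tmu.
  have [[mu' [Tmu' lt]]|no] := classic (exists mu', T mu' /\ (mu' < mu)%O); first exact: IH Tmu'.
  by exists mu; split=> // mu' Tmu'; rewrite leNgt; apply/negP => lt; apply: no; exists mu'.
have [k [m [mv E]]] := Tmu; exists k, m; split=> //; rewrite -E.
rewrite mcoeff_msupp mxE raddf_sum /= (bigD1 k) //= big1 ?addr0 => [|l lk].
  rewrite (_ : (_ * _)@_mu = (v k ord0)@_m) -?mcoeff_msupp //.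
  have [_ F1 sF] := F_marked (hd_of_in k).
  rewrite mxE -[F _](subrK 'X_[hd_of k]) mulrDl mcoeffD E addmC [_ * v k ord0]mulrC.
  rewrite [X in X + _](_ : _ = 0) ?add0r; first by rewrite mulrC mcoeffMX.
  apply/eqP; rewrite mcoeff_eq0; apply/negP => /msuppM_le /allpairsP [[a b] /= [av bF Eab]].
  have /mumin : T (a + hd_of k)%MM by exists k, a.
  by rewrite E addmC Eab lemc_add2r leNgt (sF b).
apply/eqP; rewrite mcoeff_eq0; apply/negP => /msuppM_le /allpairsP [[b a] /= [bF av Eab]].
move: bF; rewrite mxE => /(marked_at_ge (F_marked (hd_of_in l))) [bl|lt].
  move/eqP: lk; apply; apply/val_inj/eqP; rewrite -(nth_uniq 0%MM _ _ P_uniq) ?ltn_ord //.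
  apply/eqP; apply: (@cone_uniq _ _ mu); try exact: hd_of_in.
    by exists a; split; [rewrite Eab bl addmC | exact: cv av].
  by exists m; split=> //; exact: cv mv.
have /mumin : T (a + hd_of l)%MM by exists l, a.
by rewrite Eab addmC lemc_add2r leNgt lt.
Qed.

Lemma marked_row_free : cone_free marked_row hd_of.
Proof.
move=> v Av cv; apply: NNPP => /eqP v0; have [k [m [_]]] := cone_lead cv v0.
by rewrite Av mxE msupp0.
Qed.

End MarkedRow.

Section GenericInitial.
Variable I : R -> Prop.
Hypothesis idealI : is_ideal I.
Hypothesis cancel : forall d (k : 'I_n.+1) a w, a \is d.-homog ->
  ideal_of_degree I d w -> low k ('X_k * a - w) ->
  exists b, [/\ I b, b \is d.-homog & low k (a - b)].

(** Terms divisible by one of x_0, ..., x_{k-1} come after all terms of the same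
    degree in the other variables. *)
Lemma low_same_lead d k (a b : R) : a \is d.-homog -> b \is d.-homog -> a != 0 ->
  low k (a - b) -> (forall l : 'I_n.+1, (l < k)%N -> mlast a l = 0%N) ->
  b != 0 /\ mlast b = mlast a.
Proof.
move=> /homog_supported ha /homog_supported hb a0 lab ma0.
have hma := ha _ (mlast_supp a0).
have bm : mlast a \in msupp b.
  rewrite mcoeff_msupp; have -> : b@_(mlast a) = a@_(mlast a); last first.
    by rewrite -mcoeff_msupp mlast_supp.
  apply/esym/eqP; rewrite -subr_eq0 -mcoeffB mcoeff_eq0; apply/negP => /lab [l lk].
  by rewrite ma0.
split; first by apply: contraTneq bm => ->; rewrite msupp0.
apply: mlastE => // m mb; have [/mlast_lemc //|ma] := boolP (m \in msupp a).
have [|l lk ml] := lab m.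
  rewrite mcoeff_msupp mcoeffB (memN_msupp_eq0 ma) sub0r oppr_eq0.
  by rewrite -mcoeff_msupp.
by apply/ltW/(low_lt _ ma0 lk ml); rewrite hma hb.
Qed.

(** All terms after a term with smallest variable x_k are divisible by one of
    x_0, ..., x_k; this is the property of the reverse lexicographic order which
    links leading terms with the ideals (x_0, ..., x_k). *)
Lemma strand d f (k : 'I_n.+1) : f \is d.+1.-homog -> f != 0 -> mlast f k != 0%N ->
  (forall l : 'I_n.+1, (l < k)%N -> mlast f l = 0%N) ->
  let a := xquo k f in
  [/\ a \is d.-homog, a != 0, low k (f - 'X_k * a) & mlast f = (mlast a + U_(k))%MM].
Proof.
move=> /homog_supported hf f0 fk flow a; have mf := mlast_supp f0.
have suppa m : (m \in msupp a) = ((m + U_(k))%MM \in msupp f).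
  by rewrite !mcoeff_msupp mcoeff_xquo.
have [m' Em'] := mnmU_split fk.
have m'a : m' \in msupp a by rewrite suppa -Em'.
have ma : mlast a = m'.
  apply: mlastE => // m; rewrite suppa => /mlast_lemc.
  by rewrite Em' lemc_add2l.
split.
- apply/homog_supported => m; rewrite suppa => /hf.
  by rewrite mdegD mdeg1 addn1 => -[].
- by apply: contraTneq m'a => ->; rewrite msupp0.
- apply: low_split => m mf'; apply: (@le_low _ (mlast f)) => //.
    by rewrite !hf.
  exact: mlast_lemc.
- by rewrite ma.
Qed.

Lemma ideal_of_degree_gen d (a f : R) : I f -> f \is d.-homog -> ideal_of_degree I d (a * f).
Proof. by move=> If hf; exists 1, (fun _ => a), (fun _ => f); split=> //; rewrite big_ord1. Qed.

Lemma lead_set_stable : stable_set (lead_set I).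
Proof.
move=> m k i mlow ki [f [If hf f0 fm]].
have hf' : f \is (mdeg m).+1.-homog by move: hf; rewrite mdegD mdeg1 addn1.
have [|l lk|ha a0 la Ea] := strand (k := k) hf' f0.
- by rewrite fm mnmDE mnm1E eqxx addn1.
- by rewrite fm mnmDE mnm1E mlow // -val_eqE /= (gtn_eqF lk).
set a := xquo k f in ha a0 la Ea.
have am : mlast a = m by apply: (@addIm _ U_(k)%MM); rewrite -Ea.
have hxa : 'X_i * a \is (mdeg m).+1.-homog.
  by rewrite -[(mdeg m).+1]add1n; apply: dhomogM => //; apply: homogX; apply: mdeg1.
have Exa : 'X_i * a != 0 /\ mlast ('X_i * a) = (m + U_(i))%MM.
  split; first by rewrite mulf_neq0 // -msupp_eq0 msuppX.
  apply: mlastE => [|m' /msuppM_le /allpairsP [[b c] /= [/mem_msuppXP <- bf ->]]].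
    by rewrite mcoeff_msupp mulrC addmC mcoeffMX -mcoeff_msupp -am mlast_supp.
  by rewrite addmC lemc_add2r -am mlast_lemc.
have [xa0 xam] := Exa.
have [|b [Ib hb lb]] := cancel hxa (ideal_of_degree_gen 'X_i If hf') (k := k).
  have := lowM (f := 'X_i) la; rewrite mulrBr => /supportedN; rewrite opprB.
  by rewrite !mulrA ['X_i * 'X_k]mulrC.
have [|b0 bm] := low_same_lead hxa hb xa0 lb.
  by move=> l lk; rewrite xam mnmDE mnm1E mlow // -val_eqE /= (gtn_eqF (ltn_trans lk ki)).
by rewrite -xam -bm; apply: in_lead_set hb b0.
Qed.

Section Rewriting.
Variables (P : seq 'X_{1..n.+1}) (F : 'X_{1..n.+1} -> R).
Hypothesis P_cone : forall m, lead_set I m -> exists2 t, t \in P & in_cone t m.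
Hypothesis F_marked : forall t, t \in P -> marked_at t (F t).
Hypothesis F_in : forall t, t \in P -> I (F t).

(** Cancelling the smallest variable x_k of the leading term leads to a form of
    [I] of degree [d]; the cone which contains its leading term also contains the
    given one, because x_k is multiplicative for it. *)
Lemma strand_lead d f : f \is d.+1.-homog -> ideal_of_degree I d f -> f != 0 ->
  exists t m, [/\ t \in P, mlast f = (m + t)%MM, multiplicative_for t m, (mdeg t <= d)%N
    & ideal_of_degree I d ('X_[m] * F t)].
Proof.
move=> hf If f0.
have m0 : mlast f != 0%MM.
  by rewrite -mdeg_eq0 (mdeg_mlast hf).
have [k fk klow] := min_var m0; have [ha a0 la Ea] := strand hf f0 fk klow.
set a := xquo k f in ha a0 la Ea.
have [|b [Ib hb lb]] := cancel ha If (k := k).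
  by rewrite -opprB; apply: supportedN.
have alow (l : 'I_n.+1) : (l < k)%N -> mlast a l = 0%N.
  by move=> /klow /eqP; rewrite Ea mnmDE addn_eq0 => /andP [/eqP].
have [b0 bm] := low_same_lead ha hb a0 lb alow.
have [t tP [m [Em mt]]] := P_cone (in_lead_set Ib hb b0).
have dE : (mdeg m + mdeg t)%N = d.
  by rewrite -mdegD -Em; apply: mdeg_mlast.
exists t, (m + U_(k))%MM; split=> //.
- by rewrite Ea -bm Em -!addmA; congr (_ + _)%MM; apply: addmC.
- move=> i ti; rewrite mnmDE mt // mnm1E; case: eqP => // ki; subst i.
  have /nonmultP [l lk tl] := ti; move: (alow l lk); rewrite -bm Em mnmDE.
  by move/eqP; rewrite addn_eq0 (negbTE tl) andbF.
- by rewrite -dE leq_addl.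
- rewrite addmC mpolyXD -mulrA; apply: ideal_of_degree_gen; first exact/(idealM idealI)/F_in.
  by rewrite -dE; apply: dhomogM; rewrite ?dhomogX //; have [] := F_marked tP.
Qed.

(** All the subtractions of multiples of marked elements stay in the ideal
    generated in degree [d]. *)
Lemma strand_writing d f : f \is d.+1.-homog -> ideal_of_degree I d f ->
  exists Q : 'cV[R]_(size P), [/\ f = (marked_row P F *m Q) ord0 ord0,
    cone_vec (@hd_of P) Q & homog_upto (@lev_of P) d.+1 d Q].
Proof.
move: f; apply: homog_lead_ind.
  move=> _; exists 0; split; [by rewrite mulmx0 mxE|exact: cone_vec0|exact: homog_upto0].
move=> f hf f0 IH If; have [t [m [tP Em mt td Im]]] := strand_lead hf If f0.
have [hg sg] := subtract_lead hf f0 (F_marked tP) Em.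
have [|Q [E cQ hQ]] := IH _ hg sg.
  by apply: (idealB (ideal_gen_ideal _)) => //; apply: (idealZ (ideal_gen_ideal _)).
have [k Ek] := hd_of_ex tP.
exists (Q + (f@_(mlast f))%:MP *: ('X_[m] *: delta_mx k ord0)); split.
- rewrite mulmxDr [RHS]mxE -scalemxAr marked_row_delta Ek -E.
  by rewrite !mxE eqxx mulr1n mul_mpolyC subrK.
- by apply: cone_vecD => //; apply: cone_vecZ; apply: cone_vec_delta; rewrite Ek.
- apply: homog_uptoD => //; apply: homog_uptoZ; apply: homog_upto_delta.
    rewrite /lev_of Ek -mdegD -Em.
    exact: mdeg_mlast.
  by rewrite /lev_of Ek.
Qed.

Lemma marked_row_rewritable : rewritable (marked_row P F) (@hd_of P) (@lev_of P).
Proof.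
move=> k i _; have kP := hd_of_in k; have [homF _ _] := F_marked kP.
have [||Q [E cQ hQ]] := @strand_writing (lev_of k) ('X_i * F (hd_of k)).
- by rewrite -[(lev_of k).+1]add1n; apply: dhomogM => //; apply: homogX; apply: mdeg1.
- by apply: ideal_of_degree_gen => //; apply: F_in.
exists Q; split=> //; apply/matrixP => a b; rewrite (ord1 a) (ord1 b) -E.
by rewrite !mxE.
Qed.

End Rewriting.
End GenericInitial.
End LeadIdeals.

(** * Marked bases over stable sets *)

Section MarkedBases.
Variables (n : nat) (K : fieldType).
Notation R := {mpoly K[n.+1]}.
Variables (S : 'X_{1..n.+1} -> Prop) (P : seq 'X_{1..n.+1}) (F : 'X_{1..n.+1} -> R).
Hypotheses (S_up : up_closed S) (S_stable : stable_set S) (P_uniq : uniq P).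
Hypothesis PE : forall m, m \in P <-> S m /\ forall m', S m' -> (m' <= m)%MM -> m' = m.
Hypothesis P_gen : forall m, S m -> exists2 t, t \in P & (t <= m)%MM.
Hypothesis F_marked : forall t, t \in P -> marked_at t (F t).
Hypothesis F_reduced : forall t, t \in P -> supported (fun m => ~ S m) (F t - 'X_[t]).
Hypothesis F_rewritable : rewritable (marked_row P F) (@hd_of n P) (@lev_of n P).

Lemma marked_elements_gen f :
  ideal_gen (marked_elements P F) f <-> row_image (marked_row P F) f.
Proof.
split.
  apply: (ideal_gen_min (row_image_ideal _)).
  move=> g [t tP ->]; have [k Ek] := hd_of_ex tP.
  by exists (delta_mx k ord0); rewrite -colE !mxE Ek.
move=> [u ->]; apply: marked_row_in; first exact: ideal_gen_ideal.
by move=> t tP; apply: ideal_gen_in; exists t.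
Qed.

(** Writings with multiplicative coefficients show that a nonzero element of the
    ideal has a term in [S]; the other half is division. *)
Lemma stable_marked_basis : marked_basis (supported S) P F.
Proof.
have outside f : supp_outside (supported S) f <-> supported (fun m => ~ S m) f.
  by split=> h m /h; rewrite supported_mono.
have cuniq := stable_cone_uniq PE.
have Ffree := marked_row_free F_marked P_uniq cuniq.
split.
- split; first exact: pommaret_basisP.
  move=> t tP; have [h1 h2 h3] := F_marked tP; split=> //.
  by apply/outside; apply: F_reduced.
- move=> s p hp; have [u [r [E hr nr]]] := division F_marked P_gen hp.
  exists ((marked_row P F *m u) ord0 ord0), r; split=> //.
    split; first by apply/marked_elements_gen; exists u.
    by have -> : (marked_row P F *m u) ord0 ord0 = p - r; [rewrite E addrK | apply: rpredB].
  by split=> //; apply/outside.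
- move=> s p hp /marked_elements_gen [u Eu] /outside np.
  have [v cv Ev] := cone_writing u F_rewritable.
  have [v0|v0] := eqVneq v 0; first by rewrite Eu Ev v0 mulmx0 mxE.
  have [k [m [mv]]] := cone_lead F_marked P_uniq cuniq cv v0.
  rewrite -Ev -Eu => /np []; rewrite addmC; apply: up_closed_add => //.
  by have /PE [] := hd_of_in k.
Qed.

Lemma stable_resolution : exists C : complex n K, marked_resolution P F C /\ minimal C.
Proof.
apply: marked_resolution_exists => //.
exact: marked_row_free F_marked P_uniq (stable_cone_uniq PE).
Qed.

End MarkedBases.

(** * Changes of coordinates *)

Section RingHoms.

Lemma mpoly_hom_eq n (K S : comNzRingType) (phi psi : {rmorphism {mpoly K[n]} -> S}) :
  (forall c, phi c%:MP = psi c%:MP) -> (forall i, phi 'X_i = psi 'X_i) -> phi =1 psi.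
Proof.
move=> hc hx p; rewrite [p]mpolyE !raddf_sum; apply: eq_bigr => m _ /=.
rewrite -mul_mpolyC !rmorphM hc; congr (_ * _); rewrite mpolyXE_id !rmorph_prod.
by apply: eq_bigr => i _; rewrite !rmorphXn hx.
Qed.

Variables (n : nat) (K S : comNzRingType) (kappa : {rmorphism K -> S}) (g : 'M[S]_n).

(** The change of coordinates of [change_coord], preceded by the extension of
    scalars [kappa]. *)
Definition coord_map : {mpoly K[n]} -> {mpoly S[n]} :=
  mmap (@mpolyC n S \o kappa) (fun i => \sum_j g i j *: 'X_j).

HB.instance Definition _ := GRing.RMorphism.copy coord_map
  (mmap (@mpolyC n S \o kappa) (fun i => \sum_j g i j *: 'X_j)).

Lemma coord_mapC c : coord_map c%:MP = (kappa c)%:MP.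
Proof. exact: mmapC. Qed.

Lemma coord_mapX i : coord_map 'X_i = \sum_j g i j *: 'X_j.
Proof. by rewrite /coord_map mmapX mmap1U. Qed.

Lemma coord_map_homog d f : f \is d.-homog -> coord_map f \is d.-homog.
Proof.
move=> /homog_supported hf; rewrite [f]mpolyE raddf_sum big_seq; apply: rpred_sum => m mf.
rewrite /= /coord_map mmapZ /= mul_mpolyC; apply: dhomogZ; rewrite mmapX -(hf m mf).
set h := (fun i => \sum_j _).
have hom i : h i \is 1.-homog.
  by apply: rpred_sum => j _; apply: dhomogZ; rewrite dhomogX /= mdeg1.
rewrite /mmap1 mdegE.
elim: (index_enum _) => [|i s IH]; first by rewrite !big_nil; apply: dhomog1.
rewrite !big_cons; apply: dhomogM; last exact: IH.
by have := dhomogMn (m i) (hom i); rewrite mul1n.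
Qed.

End RingHoms.

Lemma map_coord_map n (K S S' : comNzRingType) (kappa : {rmorphism K -> S})
    (phi : {rmorphism S -> S'}) (kappa' : {rmorphism K -> S'}) (g : 'M[S]_n) (f : {mpoly K[n]}) :
  (forall c, kappa' c = phi (kappa c)) ->
  map_mpoly phi (coord_map kappa g f) = coord_map kappa' (map_mx phi g) f.
Proof.
move=> hk; apply: (mpoly_hom_eq (phi := map_mpoly phi \o coord_map kappa g)) => [c|i] /=.
  by rewrite !coord_mapC map_mpolyC hk.
rewrite !coord_mapX raddf_sum; apply: eq_bigr => j _.
by rewrite /= map_mpolyZ map_mpolyX mxE.
Qed.

Lemma coord_map_comp n (K S : comNzRingType) (kappa : {rmorphism K -> S}) (g h : 'M[S]_n)
    (f : {mpoly K[n]}) :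
  coord_map idfun h (coord_map kappa g f) = coord_map kappa (g *m h) f.
Proof.
apply: (mpoly_hom_eq (phi := coord_map idfun h \o coord_map kappa g)) => [c|i] /=.
  by rewrite !coord_mapC.
rewrite !coord_mapX raddf_sum /=.
transitivity (\sum_j \sum_k (g i j * h j k) *: ('X_k : {mpoly S[n]})).
  apply: eq_bigr => j _; rewrite -mul_mpolyC rmorphM /= coord_mapC coord_mapX mul_mpolyC.
  by rewrite scaler_sumr; apply: eq_bigr => k _; rewrite scalerA.
rewrite exchange_big; apply: eq_bigr => k _; rewrite mxE scaler_suml.
by apply: eq_bigr.
Qed.

Lemma coord_map1 n (S : comNzRingType) (f : {mpoly S[n]}) : coord_map idfun 1%:M f = f.
Proof.
apply: (mpoly_hom_eq (phi := coord_map idfun 1%:M) (psi := idfun)) => [c|i].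
  exact: coord_mapC.
rewrite /= coord_mapX (bigD1 i) //= mxE eqxx scale1r big1 ?addr0 // => j ji.
by rewrite mxE eq_sym (negbTE ji) scale0r.
Qed.

Lemma change_coordE n (K : fieldType) (g : 'M[K]_n.+1) (f : {mpoly K[n.+1]}) :
  change_coord g f = coord_map idfun g f.
Proof.
apply: (mpoly_hom_eq (phi := comp_mpoly _) (psi := coord_map idfun g)) => [c|i].
  by rewrite /= coord_mapC; apply: comp_mpolyC.
rewrite /= coord_mapX comp_mpolyXU -tnth_nth tnth_mktuple.
by apply: eq_bigr.
Qed.

(** * Torsion in generic coordinates *)

Section Shift.
Variables (A : comNzRingType) (Theta : {rmorphism A -> {poly A}}) (G : A -> Prop).
Hypotheses (G0 : G 0) (GD : forall a b, G a -> G b -> G (a + b)).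
Hypothesis GM : forall a b, G b -> G (a * b).
Hypothesis G_Theta : forall f i, G f -> G (Theta f)`_i.
Hypothesis Theta_0 : forall f, (Theta f)`_0 = f.

(** Write Theta f as a polynomial in the new variable s.  The relation
    (y + s z) Theta f in G[s] gives z times the top coefficient in G, and then,
    going down, a power of z times each coefficient; the last one is f. *)
Lemma shift_torsion y z f : Theta y = y%:P + z *: 'X -> G (y * f) ->
  exists N, G (z ^+ N * f).
Proof.
move=> Ey Gyf; set W := Theta f; pose M := size W.
have step i : G (y * W`_i.+1 + z * W`_i).
  have := G_Theta i.+1 Gyf; rewrite rmorphM /= -/W Ey mulrDl coefD coefCM.
  by rewrite -scalerAl coefZ coefXM.
have all j : (j <= M)%N -> G (z ^+ j * W`_(M - j)).
  elim: j => [|j IH] jM; first by rewrite subn0 nth_default // mulr0.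
  have -> : z ^+ j.+1 * W`_(M - j.+1) =
     z ^+ j * (y * W`_(M - j) + z * W`_(M - j.+1)) + (- y) * (z ^+ j * W`_(M - j)).
    by rewrite exprSr mulrDr mulrCA mulNr addrAC subrr add0r mulrA.
  apply: GD; last by apply: GM; apply: IH; apply: ltnW.
  by apply: GM; have := step (M - j.+1)%N; rewrite subnSK.
by exists M; have := all M (leqnn M); rewrite subnn Theta_0.
Qed.

End Shift.

(** The substitution x_k -> x_k + s x_j in a linear form is undone by replacing its
    coefficient c_j by c_j - s c_k. *)
Lemma shear_sum (B : comNzRingType) (I : finType) (c x : I -> B) (s : B) (k j : I) :
  j != k ->
  \sum_l (c l - (l == j)%:R * (c k * s)) * (x l + (l == k)%:R * (x j * s))
  = \sum_l c l * x l.
Proof.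
move=> jk; apply/eqP; rewrite -subr_eq0 -sumrB (bigD1 k) //= (bigD1 j) //=.
rewrite big1 => [|l /andP [/negbTE lk /negbTE lj]].
  rewrite !eqxx (negbTE jk) [k == j]eq_sym (negbTE jk) !mul0r !mul1r subr0 !addr0.
  by rewrite mulrDr mulrBl [c k * x k + _]addrC addrK addrAC subrr sub0r mulrAC mulrA subrr.
by rewrite lk lj !mul0r subr0 addr0 subrr.
Qed.

Section GenericShift.
Variables (n : nat) (K : fieldType).
Notation N := (n.+1 * n.+1)%N.
Notation T := {mpoly K[N]}.
Notation A := {mpoly T[n.+1]}.

Definition generic_mx : 'M[T]_n.+1 := vec_mx (\row_a 'X_a).

Definition generic_coord : {mpoly K[n.+1]} -> A := coord_map (@mpolyC N K) generic_mx.

HB.instance Definition _ := GRing.RMorphism.copy generic_coord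
  (coord_map (@mpolyC N K) generic_mx).

Lemma mxvec_generic (a : 'I_N) : mxvec generic_mx ord0 a = 'X_a.
Proof. by rewrite /generic_mx vec_mxK mxE. Qed.

Section ShiftVariable.
Variables k j : 'I_n.+1.
Hypothesis jk : j != k.

Definition shift_const : K -> {poly A} := polyC \o (@mpolyC n.+1 T \o @mpolyC N K).
HB.instance Definition _ := GRing.RMorphism.copy shift_const
  (polyC \o (@mpolyC n.+1 T \o @mpolyC N K)).

Definition shift_mx : 'M[{poly A}]_n.+1 :=
  \matrix_(i, l) ((generic_mx i l)%:MP%:P - (l == j)%:R * (((generic_mx i k)%:MP)%:P * 'X)).

Definition shift_coef : T -> {poly A} := mmap shift_const (fun a => mxvec shift_mx ord0 a).
HB.instance Definition _ := GRing.RMorphism.copy shift_coef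
  (mmap shift_const (fun a => mxvec shift_mx ord0 a)).

Definition shift_var (l : 'I_n.+1) : {poly A} := ('X_l)%:P + (l == k)%:R * (('X_j)%:P * 'X).

(** x_k -> x_k + s x_j together with the transformation of the generic matrix
    that undoes it on the generic linear forms. *)
Definition shift : A -> {poly A} := mmap shift_coef shift_var.
HB.instance Definition _ := GRing.RMorphism.copy shift (mmap shift_coef shift_var).

Lemma shift_coef_entry i l : shift_coef (generic_mx i l) = shift_mx i l.
Proof.
rewrite /shift_coef -[generic_mx i l]mxvecE mxvec_generic mmapX mmap1U.
by rewrite mxvecE.
Qed.

Lemma shift_generic f : shift (generic_coord f) = (generic_coord f)%:P.
Proof.
apply: (mpoly_hom_eq (phi := shift \o generic_coord) (psi := polyC \o generic_coord)).
  by move=> c; rewrite /= /generic_coord coord_mapC /shift mmapC /= /shift_coef mmapC.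
move=> i; rewrite /= /generic_coord coord_mapX !raddf_sum /=.
pose c l : {poly A} := (generic_mx i l)%:MP%:P; pose x l : {poly A} := ('X_l)%:P.
have E l : generic_mx i l *: 'X_l = (generic_mx i l)%:MP * ('X_l : A).
  by rewrite mul_mpolyC.
transitivity (\sum_l (c l - (l == j)%:R * (c k * 'X)) * (x l + (l == k)%:R * (x j * 'X))).
  apply: eq_bigr => l _; rewrite E rmorphM /= /shift mmapC mmapX mmap1U.
  by rewrite /= shift_coef_entry mxE.
rewrite shear_sum //; apply: eq_bigr => l _.
by rewrite E polyCM.
Qed.

Lemma shift_at0 f : (shift f)`_0 = f.
Proof.
rewrite -horner_coef0.
apply: (mpoly_hom_eq (phi := horner_eval 0 \o shift) (psi := idfun)) => [c|i] /=.
  rewrite /shift mmapC; apply: (mpoly_hom_eq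
     (phi := horner_eval 0 \o shift_coef) (psi := @mpolyC n.+1 T)) => [{}c|a] /=.
    by rewrite /shift_coef mmapC /= /horner_eval hornerC.
  case/mxvec_indexP: a => i l; rewrite -mxvec_generic mxvecE shift_coef_entry mxE.
  by rewrite /horner_eval hornerD hornerN !hornerM hornerX !mulr0 subr0 hornerC.
by rewrite /shift mmapX mmap1U /horner_eval /shift_var hornerD !hornerM hornerX !mulr0 addr0 hornerC.
Qed.

Lemma shift_varE : shift 'X_k = ('X_k)%:P + 'X_j *: 'X.
Proof. by rewrite /shift mmapX mmap1U /shift_var eqxx mul1r mul_polyC. Qed.

Lemma low_shift (f : A) i : low k f -> low k (shift f)`_i.
Proof.
move=> lf; rewrite [f]mpolyE raddf_sum coef_sum big_seq; apply: supported_sum => m mf.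
have [l lk ml] := lf m mf; have [m' ->] := mnmU_split ml.
have El : shift 'X_l = ('X_l)%:P.
  by rewrite /shift mmapX mmap1U /shift_var -val_eqE /= (ltn_eqF lk) mul0r addr0.
rewrite /= -mul_mpolyC mpolyXD mulrA rmorphM /= El coefMC; apply: lowM.
by apply: supportedX; exists l => //; rewrite mnm1E eqxx.
Qed.

End ShiftVariable.

(** The relations are generated by polynomials in generic coordinates and by the
    variables before x_k; [shift] fixes all of them. *)
Lemma generic_torsion r (h : 'rV[{mpoly K[n.+1]}]_r) (k j : 'I_n.+1) (f : A) :
  let B := map_mx generic_coord h in
  (exists v : 'cV[A]_r, low k ('X_k * f - (B *m v) ord0 ord0)) ->
  exists N, exists v : 'cV[A]_r, low k ('X_j ^+ N * f - (B *m v) ord0 ord0).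
Proof.
move=> B hf; have [->|jk] := eqVneq j k; first by exists 1%N; rewrite expr1.
pose G (f : A) := exists v : 'cV[A]_r, low k (f - (B *m v) ord0 ord0).
apply: (@shift_torsion _ (shift k j) G _ _ _ _ _ 'X_k); last exact: hf.
- by exists 0; rewrite mulmx0 mxE subr0; apply: supported0.
- move=> a b [v lv] [w lw]; exists (v + w); rewrite mulmxDr mxE opprD addrACA.
  exact: supportedD.
- move=> a b [v lv]; exists (a *: v); rewrite -scalemxAr mxE -mulrBr.
  exact: lowM.
- move=> a i [v lv]; exists (map_mx (fun p : {poly A} => p`_i) (map_mx (shift k j) v)).
  have := low_shift (j := j) (i := i) lv; rewrite rmorphB coefB; congr (low k (_ - _)).
  rewrite !mxE raddf_sum coef_sum; apply: eq_bigr => l _.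
  by rewrite /= rmorphM /= !mxE shift_generic // coefCM.
- exact: shift_at0.
- exact: shift_varE.
Qed.

End GenericShift.
Arguments generic_coord {n K} f.

(** * Passing to rational functions *)

Section Denominators.
Variables (T : idomainType) (L : fieldType) (phi : {rmorphism T -> L}).
Hypothesis phi_frac : forall x, exists q t, q != 0 /\ phi q * x = phi t.
Variable n : nat.

(** [q] is a common denominator of the coefficients of [f]. *)
Definition clearable (q : T) (f : {mpoly L[n]}) : Prop :=
  exists ft : {mpoly T[n]}, phi q *: f = map_mpoly phi ft.

Lemma clearable_mull q q' f : clearable q f -> clearable (q' * q) f.
Proof.
move=> [ft E]; exists (q' *: ft).
by rewrite rmorphM -scalerA E -[RHS]/(map_mpoly phi _) map_mpolyZ.
Qed.

Lemma clear_seq (I : eqType) (s : seq I) (C : T -> I -> Prop) :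
  (forall q q' i, C q i -> C (q' * q) i) ->
  (forall i, exists2 q, q != 0 & C q i) ->
  exists2 q, q != 0 & forall i, i \in s -> C q i.
Proof.
move=> CM Cex; elim: s => [|i s [q q0 hq]]; first by exists 1; rewrite ?oner_neq0.
have [q' q'0 hq'] := Cex i; exists (q * q'); first by rewrite mulf_neq0.
move=> j; rewrite inE => /predU1P [->|js]; first exact: CM.
by rewrite mulrC; apply: CM; apply: hq.
Qed.

Lemma clearable_ex f : exists2 q, q != 0 & clearable q f.
Proof.
have [||q q0 hq] := @clear_seq _ (msupp f) (fun q m => clearable q (f@_m *: 'X_[m])).
- by move=> q q' m; apply: clearable_mull.
- move=> m; have [q [t [q0 E]]] := phi_frac f@_m; exists q => //.
  by exists (t *: 'X_[m]); rewrite scalerA E map_mpolyZ map_mpolyX.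
exists q => //; rewrite [f]mpolyE big_seq; apply: (big_ind (clearable q)) => //.
- by exists 0; rewrite scaler0 raddf0.
- by move=> a b [a' Ea] [b' Eb]; exists (a' + b'); rewrite scalerDr Ea Eb raddfD.
Qed.

Lemma clear_family (I : finType) (f : I -> {mpoly L[n]}) :
  exists2 q, q != 0 & forall i, clearable q (f i).
Proof.
have [||q q0 hq] := @clear_seq _ (enum I) (fun q i => clearable q (f i)).
- by move=> q q' m; apply: clearable_mull.
- by move=> i; apply: clearable_ex.
by exists q => // i; apply: hq; rewrite mem_enum.
Qed.

Lemma clear_mx p r (A : 'M[{mpoly L[n]}]_(p, r)) :
  exists q, exists At : 'M[{mpoly T[n]}]_(p, r),
    q != 0 /\ (phi q)%:MP *: A = map_mx (map_mpoly phi) At.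
Proof.
have [q q0 hq] := clear_family (fun ij : 'I_p * 'I_r => A ij.1 ij.2).
have [At hA] := fin_all_exists hq.
exists q, (\matrix_(i, j) At (i, j)); split=> //; apply/matrixP => i j.
by rewrite !mxE mul_mpolyC -(hA (i, j)).
Qed.

End Denominators.

Section OverFractionField.
Variables (n : nat) (K : fieldType).
Notation N := (n.+1 * n.+1)%N.
Notation T := {mpoly K[N]}.
Variables (L : fieldType) (phi : {rmorphism T -> L}).
Hypothesis phi_inj : injective phi.
Hypothesis phi_frac : forall x, exists q t, q != 0 /\ phi q * x = phi t.

Lemma phi_neq0 q : q != 0 -> phi q != 0.
Proof. by move=> q0; rewrite -(rmorph0 phi) (inj_eq phi_inj). Qed.

Definition scalar_ext : K -> L := phi \o @mpolyC N K.
HB.instance Definition _ := GRing.RMorphism.copy scalar_ext (phi \o @mpolyC N K).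

Definition generic_point : 'M[L]_n.+1 := map_mx phi (generic_mx n K).

(** Over the field L, but not over T, the generic matrix is invertible. *)
Definition genericL : {mpoly K[n.+1]} -> {mpoly L[n.+1]} := coord_map scalar_ext generic_point.
HB.instance Definition _ := GRing.RMorphism.copy genericL (coord_map scalar_ext generic_point).

Lemma genericLE f : genericL f = map_mpoly phi (generic_coord f).
Proof. by rewrite /generic_coord (map_coord_map (kappa' := scalar_ext)). Qed.

Lemma generic_point_unit : generic_point \in unitmx.
Proof.
rewrite unitmxE unitfE det_map_mx; apply: phi_neq0; apply/eqP => d0.
have : (mmap idfun (fun a => mxvec (1%:M : 'M[K]_n.+1) ord0 a) (\det (generic_mx n K)) : K) = 1.
  rewrite -det_map_mx -[RHS](det1 _ n.+1); congr (\det _); apply/matrixP => i l.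
  by rewrite mxE -[generic_mx n K i l]mxvecE mxvec_generic /= mmapX mmap1U mxvecE.
by rewrite d0 mmap0 => /eqP; rewrite eq_sym oner_eq0.
Qed.

Lemma map_mpoly_inj m : injective (map_mpoly phi : {mpoly T[m]} -> {mpoly L[m]}).
Proof.
move=> f f' E; apply/mpolyP => a; apply: phi_inj.
by rewrite -!mcoeff_map_mpoly E.
Qed.

Lemma map_mx_inj p r : injective (map_mx (map_mpoly phi) : 'M[{mpoly T[n.+1]}]_(p, r) -> _).
Proof.
move=> M M' E; apply/matrixP => i j; apply: map_mpoly_inj.
by have := congr1 (fun X : 'M_(_, _) => X i j) E; rewrite !mxE.
Qed.

Lemma low_map k (f : {mpoly T[n.+1]}) : low k (map_mpoly phi f) <-> low k f.
Proof.
by split=> h m; have := h m; rewrite (perm_mem (msupp_map_mpoly _ phi_inj)).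
Qed.

(** Clearing denominators reduces this to [generic_torsion]. *)
Lemma torsionL r (h : 'rV[{mpoly K[n.+1]}]_r) (k j : 'I_n.+1) (w : 'cV[{mpoly L[n.+1]}]_1) :
  let B := map_mx genericL h in
  (exists v : 'cV_r, lowv k ('X_k *: w - B *m v)) ->
  exists a, exists v : 'cV_r, lowv k ('X_j ^+ a *: w - B *m v).
Proof.
move=> B [v lv]; have BE : B = map_mx (map_mpoly phi) (map_mx generic_coord h).
  by apply/matrixP => a b; rewrite !mxE genericLE.
have [q1 [wt [q10 Ew]]] := clear_mx phi_frac w; have [q2 [vt [q20 Ev]]] := clear_mx phi_frac v.
pose W := q2%:MP *: wt; pose V := q1%:MP *: vt; pose q := q1 * q2.
have EW : map_mx (map_mpoly phi) W = (phi q)%:MP *: w.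
  by rewrite map_mxZ /= map_mpolyC -Ew scalerA -mpolyCM -rmorphM [q2 * q1]mulrC.
have EV : map_mx (map_mpoly phi) V = (phi q)%:MP *: v.
  by rewrite map_mxZ /= map_mpolyC -Ev scalerA -mpolyCM -rmorphM.
have q0 : q != 0 by rewrite mulf_neq0.
clearbody q W V.
have [|a [v' lv']] := @generic_torsion _ _ _ h k j (W ord0 ord0).
  exists V; apply/low_map.
  have := lowvZ (f := (phi q)%:MP) lv => /(_ ord0 ord0).
  congr low; rewrite scalerBr scalerA mulrC -scalerA scalemxAr -EW -EV BE -map_mxM.
  by rewrite mxBE rmorphB rmorphM /= map_mpolyX !mxE.
exists a, ((phi q)^-1%:MP *: map_mx (map_mpoly phi) v') => x y.
rewrite (ord1 x) (ord1 y); move/low_map: lv' => lv'.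
have := lowM (f := (phi q)^-1%:MP) lv'; congr low.
rewrite rmorphB /= rmorphM /= rmorphXn /= map_mpolyX mulrBr mulrCA.
rewrite -scalemxAr BE -map_mxM mxBE; congr (_ - _); last first.
  by rewrite [RHS]mxE [X in _ = _ * X]mxE.
rewrite [RHS]mxE; congr (_ * _).
have -> : map_mpoly phi (W ord0 ord0) = ((phi q)%:MP *: w) ord0 ord0 by rewrite -EW mxE.
by rewrite mxE mulrA -mpolyCM mulVf ?mul1r // phi_neq0.
Qed.

Definition t_coef (a : 'X_{1..N}) : {mpoly T[n.+1]} -> {mpoly K[n.+1]} := map_mpoly (mcoeff a).

Lemma t_coefM a (f : {mpoly K[n.+1]}) (u : {mpoly T[n.+1]}) :
  t_coef a (map_mpoly (@mpolyC N K) f * u) = f * t_coef a u.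
Proof.
apply/mpolyP => m; rewrite mcoeff_map_mpoly !mcoeffM raddf_sum; apply: eq_bigr => -[b c] _ /=.
by rewrite !mcoeff_map_mpoly mcoeffCM.
Qed.

Lemma t_coef_expand b (u : {mpoly T[n.+1]}) : (forall m, (msize u@_m <= b)%N) ->
  u = \sum_(a : 'X_{1..N < b}) 'X_[a]%:MP * map_mpoly (@mpolyC N K) (t_coef a u).
Proof.
move=> hb; apply/mpolyP => m; rewrite raddf_sum /= [LHS](mpolywE (hb m)).
apply: eq_bigr => a _; rewrite mcoeffCM !mcoeff_map_mpoly /= mulrC.
by rewrite mul_mpolyC.
Qed.

(** The polynomials over T = K[t] form a free module over K[x] on the terms of T,
    and the matrices act on each coefficient separately. *)
Lemma exact_base_change a b c (M : 'M[{mpoly K[n.+1]}]_(a, b)) (M' : 'M_(b, c)) :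
  (forall u : 'cV_b, M *m u = 0 -> exists v : 'cV_c, u = M' *m v) ->
  let ext := map_mpoly (@mpolyC N K) in
  forall u : 'cV[{mpoly T[n.+1]}]_b, map_mx ext M *m u = 0 ->
  exists v : 'cV_c, u = map_mx ext M' *m v.
Proof.
move=> ex ext u Mu.
pose B := \max_i \max_(m <- msupp (u i ord0)) msize (u i ord0)@_m.
have hB i m : (msize (u i ord0)@_m <= B)%N.
  have [mu|nmu] := boolP (m \in msupp (u i ord0)); last first.
    by rewrite memN_msupp_eq0 // msize0.
  by apply: leq_trans (leq_bigmax i); rewrite (big_rem m) //= leq_maxl.
have ht (al : 'X_{1..N < B}) : exists v : 'cV_c, map_mx (t_coef al) u = M' *m v.
  apply: ex; apply/matrixP => i j; rewrite (ord1 j).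
  transitivity (t_coef al ((map_mx ext M *m u) i ord0)); last first.
    by rewrite Mu !mxE /t_coef raddf0.
  rewrite !mxE /t_coef raddf_sum; apply: eq_bigr => l _.
  by rewrite !mxE -/(t_coef al _) -t_coefM.
have [v hv] := fin_all_exists ht.
exists (\sum_(al : 'X_{1..N < B}) 'X_[al]%:MP *: map_mx ext (v al)).
rewrite mulmx_sumr; apply/matrixP => i j; rewrite (ord1 j) summxE.
rewrite [LHS](t_coef_expand (hB i)); apply: eq_bigr => al _.
rewrite -scalemxAr -map_mxM -hv !mxE; congr (_ * _).
Qed.

(** Over L the generic coordinates are invertible, and undoing them leaves an
    extension of scalars, which is treated by clearing denominators. *)
Lemma exactL a b c (M : 'M[{mpoly K[n.+1]}]_(a, b)) (M' : 'M_(b, c)) :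
  (forall u : 'cV_b, M *m u = 0 -> exists v : 'cV_c, u = M' *m v) ->
  forall u : 'cV[{mpoly L[n.+1]}]_b, map_mx genericL M *m u = 0 ->
  exists v : 'cV_c, u = map_mx genericL M' *m v.
Proof.
move=> ex u Mu; pose ext := map_mpoly (@mpolyC N K) : {mpoly K[n.+1]} -> {mpoly T[n.+1]}.
pose back := coord_map idfun (invmx generic_point); pose forth := coord_map idfun generic_point.
have backK f : back (genericL f) = map_mpoly phi (ext f).
  rewrite /back /genericL coord_map_comp mulmxV ?generic_point_unit //.
  apply: (mpoly_hom_eq (phi := coord_map scalar_ext 1%:M) (psi := map_mpoly phi \o ext)).
    by move=> x; rewrite /= coord_mapC /ext !map_mpolyC.
  move=> i; rewrite /= coord_mapX /ext !map_mpolyX (bigD1 i) //= mxE eqxx scale1r.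
  by rewrite big1 ?addr0 // => j ji; rewrite mxE eq_sym (negbTE ji) scale0r.
have forthK f : forth (back f) = f.
  by rewrite /forth /back coord_map_comp mulVmx ?generic_point_unit // coord_map1.
have [q [ut [q0 Eu]]] := clear_mx phi_frac (map_mx back u).
have Mut : map_mx ext M *m ut = 0.
  apply: map_mx_inj; rewrite map_mxM -Eu map_mx0 -scalemxAr.
  have -> : map_mx (map_mpoly phi) (map_mx ext M) = map_mx back (map_mx genericL M).
    by apply/matrixP => i j; rewrite !mxE backK.
  by rewrite -map_mxM Mu map_mx0 scaler0.
have [v Ev] := exact_base_change ex Mut.
exists (map_mx forth ((phi q)^-1%:MP *: map_mx (map_mpoly phi) v)).
have -> : map_mx genericL M' = map_mx forth (map_mx (map_mpoly phi) (map_mx ext M')).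
  by apply/matrixP => i j; rewrite !mxE -backK forthK.
rewrite -map_mxM -scalemxAr -map_mxM -Ev -Eu scalerA -mpolyCM mulVf ?phi_neq0 //.
rewrite scale1r; apply/matrixP => i j; rewrite [RHS]mxE [in RHS]mxE.
exact/esym/forthK.
Qed.

End OverFractionField.

(** * Componentwise linear ideals at the generic point *)

Section GenericIdeal.
Variables (n : nat) (K : fieldType).
Notation N := (n.+1 * n.+1)%N.
Notation T := {mpoly K[N]}.
Variables (L : fieldType) (phi : {rmorphism T -> L}).
Hypothesis phi_inj : injective phi.
Hypothesis phi_frac : forall x, exists q t, q != 0 /\ phi q * x = phi t.
Notation theta := (@genericL n K L phi).
Notation RL := {mpoly L[n.+1]}.

(** Membership in the linear span, stated as an induction principle. *)
Definition spanned (G : RL -> Prop) (f : RL) : Prop := forall W : RL -> Prop,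
  W 0 -> (forall a b, W a -> W b -> W (a + b)) -> (forall c a, W a -> W (c *: a)) ->
  (forall g, G g -> W g) -> W f.

Definition generic_ideal (I : {mpoly K[n.+1]} -> Prop) : RL -> Prop :=
  ideal_gen (fun f => exists2 h, I h & f = theta h).

Lemma pihomog_theta d h : pihomog mdeg d (theta h) = theta (pihomog mdeg d h).
Proof.
set b := maxn (msize h) d.+1; have hb : (msize h <= b)%N by rewrite leq_maxl.
have db : (d < b)%N by rewrite leq_maxr.
have E : theta h = \sum_(e < b) theta (pihomog mdeg e h).
  by rewrite -[LHS]/(theta h) [in LHS](pihomog_partitionE hb) [LHS]raddf_sum.
transitivity (\sum_(e < b) pihomog mdeg d (theta (pihomog mdeg e h))).
  by rewrite E [LHS]raddf_sum.
have hom e : theta (pihomog mdeg e h) \is e.-homog.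
  by rewrite /genericL coord_map_homog // pihomogP.
rewrite (bigD1 (Ordinal db)) //= big1 ?addr0 => [|e ed].
  exact: pihomog_dE.
by apply: pihomog_ne0 (hom e).
Qed.

(** The image of a polynomial under generic coordinates spans, over L, what it
    generates: variables are L-combinations of images of variables.  Taking parts of
    degree [d] then stays inside the span of forms of I. *)
Lemma generic_ideal_span I d f : graded_ideal I -> generic_ideal I f -> f \is d.-homog ->
  spanned (fun g => exists h, [/\ I h, h \is d.-homog & g = theta h]) f.
Proof.
move=> [idI grI] If hf.
have {If} : spanned (fun g => exists2 h, I h & g = theta h) f.
  apply: ideal_gen_min If => [|g Gg W _ _ _]; last exact.
  split=> [W //|a b sa sb W W0 WD WZ WG|a b sb W W0 WD WZ WG].
    exact: WD (sa W W0 WD WZ WG) (sb W W0 WD WZ WG).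
  apply: (sb (fun b => W (a * b))) => [|x y|c x|g [h Ih ->]].
  - by rewrite mulr0.
  - by rewrite mulrDr; apply: WD.
  - by rewrite -scalerAr; apply: WZ.
  have -> : a = coord_map idfun (generic_point phi) (coord_map idfun (invmx (generic_point phi)) a).
    by rewrite coord_map_comp mulVmx ?generic_point_unit // coord_map1.
  move: (coord_map _ (invmx _) a) => {}a; rewrite [a]mpolyE raddf_sum mulr_suml.
  apply: (big_ind W) => // m _; rewrite /= -mul_mpolyC rmorphM /= coord_mapC mul_mpolyC.
  rewrite -scalerAl; apply: WZ.
  have -> : coord_map idfun (generic_point phi) 'X_[m] = theta 'X_[m].
    rewrite [in LHS]mpolyXE_id [in RHS]mpolyXE_id [LHS]rmorph_prod.
    rewrite [RHS]rmorph_prod; apply: eq_bigr => i _.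
    rewrite !rmorphXn /=.
    by rewrite coord_mapX /genericL coord_mapX.
  by rewrite -rmorphM; apply: WG; exists ('X_[m] * h) => //; apply: idealM.
move=> sp W W0 WD WZ WG; rewrite -(pihomog_dE hf).
apply: (sp (fun f => W (pihomog mdeg d f))) => [|a b Wa Wb|c a Wa|g [h Ih ->]].
- by rewrite raddf0.
- by rewrite raddfD; apply: WD.
- by rewrite linearZ; apply: WZ.
- by rewrite pihomog_theta; apply: WG; exists (pihomog mdeg d h); split; [apply: grI|apply: pihomogP|].
Qed.

Lemma ideal_of_degree_sub (I : {mpoly K[n.+1]} -> Prop) d f :
  is_ideal I -> ideal_of_degree I d f -> I f.
Proof. by move=> idI; apply: ideal_gen_min => // g []. Qed.

Lemma generic_ideal_homog I d f : graded_ideal I -> generic_ideal I f -> f \is d.-homog ->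
  generic_ideal (ideal_of_degree I d) f.
Proof.
move=> gI If hf; apply: (generic_ideal_span gI If hf) => [|a b|c a|g [h [Ih hh ->]]].
- exact: (ideal0 (ideal_gen_ideal _)).
- exact: (idealD (ideal_gen_ideal _)).
- exact: (idealZ (ideal_gen_ideal _)).
- by apply: ideal_gen_in; exists h => //; apply: ideal_gen_in.
Qed.

(** [linear_cancel] for the linear resolution of the ideal generated by I_d,
    transported to the generic point.  The preimage may be taken constant for
    reasons of degree, and then its image is a combination of forms of degree d
    of the ideal. *)
Lemma generic_cancel I d (k : 'I_n.+1) a w : graded_ideal I ->
  has_linear_resolution (ideal_of_degree I d) d ->
  a \is d.-homog -> ideal_of_degree (generic_ideal I) d w -> low k ('X_k * a - w) ->
  exists b, [/\ generic_ideal I b, b \is d.-homog & low k (a - b)].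
Proof.
move=> gI [C [[homC genC exC] _ linC]] ha Iw lw; have [idI _] := gI.
have dgC t j : @dg _ _ C t j = (t + d)%N.
  apply: linC; rewrite -lt0n; apply/card_gt0P; exists j.
  by rewrite inE.
pose D t : 'M_(tgt_rk (rk C) t, rk C t) := map_mx theta (dif C t).
have C_homog t i j : dif C t i j \is (deg_of d t).-homog.
  apply/homog_supported => m /homC; rewrite dgC.
  by case: t i j => [|t] i j /=; rewrite ?addn0 // dgC; lia.
have D_homog t i j : D t i j \is (deg_of d t).-homog.
  by rewrite mxE /genericL coord_map_homog.
have C_cplx t : dif C t *m dif C t.+1 = 0.
  apply/matrixP => i j; have : dif C t *m col j (dif C t.+1) = 0.
    by apply/exC; exists (delta_mx j ord0); rewrite colE.
  by rewrite -col_mulmx => /(congr1 (fun M : 'cV__ => M i ord0)); rewrite [LHS]mxE => ->; rewrite !mxE.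
have D_cplx t : D t *m D t.+1 = 0 by rewrite -map_mxM C_cplx map_mx0.
have D_exact t (u : 'cV_(rk C t)) : D t *m u = 0 -> exists v, u = D t.+1 *m v.
  by apply: exactL => // v; move/exC.
have tors (k' j : 'I_n.+1) : torsion_at D 0 k' j by move=> x; apply: (torsionL phi_inj phi_frac).
pose imD := @row_image n L (rk C 0) (D 0%N); have imD_ideal := row_image_ideal (D 0%N).
have Dw : imD w.
  apply: (ideal_gen_min imD_ideal) Iw => g [Ig hg].
  apply: (ideal_gen_min imD_ideal) (generic_ideal_homog gI Ig hg) => f [h Ih ->].
  have /genC [u ->] := Ih; exists (map_mx theta u).
  by rewrite -map_mxM [RHS]mxE.
have [v Ew] := Dw.
have [||y ly] := @linear_cancel n L (rk C) D d D_homog D_cplx D_exact tors k a%:M v.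
- move=> i m dm; rewrite (ord1 i) mxE eqxx mulr1n; apply/eqP; rewrite mcoeff_eq0.
  apply/negP => ma; have /homog_supported/(_ m ma) := ha; lia.
- move=> i j; rewrite (ord1 i) (ord1 j); move: lw; congr low.
  by rewrite mxBE Ew [in RHS]mxE [in RHS]mxE eqxx mulr1n.
exists ((D 0%N *m const_part y) ord0 ord0); split.
- rewrite mxE; apply: (big_ind (generic_ideal I)).
  + exact: (ideal0 (ideal_gen_ideal _)).
  + exact: (idealD (ideal_gen_ideal _)).
  + move=> l _; rewrite mulrC; apply: (idealM (ideal_gen_ideal _)); apply: ideal_gen_in.
    rewrite mxE; exists (dif C 0 ord0 l) => //; apply: (ideal_of_degree_sub (d := d)) => //.
    by apply/genC; exists (delta_mx l ord0); rewrite -colE [RHS]mxE.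
- exact: (homog_const_part (e := d)).
- have ha' (i : 'I_1) : (a%:M : 'cV_1) i ord0 \is d.-homog.
    by rewrite (ord1 i) mxE eqxx mulr1n.
  have := take_constants (D_homog 0%N) ha' ly => /(_ ord0 ord0).
  by rewrite mxBE [X in low _ (X - _)]mxE eqxx mulr1n.
Qed.

End GenericIdeal.

(** * Specialisation of the generic point *)

Section Specialisation.
Variables (n : nat) (K : fieldType).
Notation N := (n.+1 * n.+1)%N.
Notation T := {mpoly K[N]}.
Variables (L : fieldType) (phi : {rmorphism T -> L}).
Hypothesis phi_inj : injective phi.
Variable g : 'M[K]_n.+1.

Definition eval_at : T -> K := mmap idfun (fun a => mxvec g ord0 a).
HB.instance Definition _ := GRing.RMorphism.copy eval_at (mmap idfun (fun a => mxvec g ord0 a)).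

(** [f'] is the value of [f] at [g], computed with some denominator [q] that does not
    vanish at [g]. *)
Definition specialises (f : {mpoly L[n.+1]}) (f' : {mpoly K[n.+1]}) : Prop :=
  exists q ft, [/\ eval_at q != 0, phi q *: f = map_mpoly phi ft
    & eval_at q *: f' = map_mpoly eval_at ft].

Lemma specialises_uniq f a b : specialises f a -> specialises f b -> a = b.
Proof.
move=> [q [ft [q0 Ef Ea]]] [q' [ft' [q'0 Ef' Eb]]].
have E : q' *: ft = q *: ft'.
  apply: (map_mpoly_inj phi_inj); rewrite !map_mpolyZ -Ef -Ef' !scalerA.
  by rewrite mulrC.
have := congr1 (map_mpoly eval_at) E; rewrite !map_mpolyZ -Ea -Eb !scalerA mulrC.
by apply: scalerI; rewrite mulf_neq0.
Qed.

Lemma specialisesD f h f' h' : specialises f f' -> specialises h h' ->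
  specialises (f + h) (f' + h').
Proof.
move=> [q [ft [q0 Ef Ea]]] [q' [ft' [q'0 Ef' Eb]]].
exists (q * q'), (q' *: ft + q *: ft'); rewrite !rmorphM mulf_neq0 //; split=> //.
  by rewrite [RHS]raddfD /= !map_mpolyZ -Ef -Ef' !scalerA scalerDr [phi q' * _]mulrC.
by rewrite [RHS]raddfD /= !map_mpolyZ -Ea -Eb !scalerA scalerDr [eval_at q' * _]mulrC.
Qed.

Lemma specialisesM f h f' h' : specialises f f' -> specialises h h' ->
  specialises (f * h) (f' * h').
Proof.
move=> [q [ft [q0 Ef Ea]]] [q' [ft' [q'0 Ef' Eb]]].
exists (q * q'), (ft * ft'); rewrite !rmorphM mulf_neq0 //=; split=> //.
  by rewrite -Ef -Ef' -scalerAl -scalerAr scalerA.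
by rewrite -Ea -Eb -scalerAl -scalerAr scalerA.
Qed.

Lemma specialises_map (ft : {mpoly T[n.+1]}) :
  specialises (map_mpoly phi ft) (map_mpoly eval_at ft).
Proof. by exists 1, ft; rewrite !rmorph1 oner_neq0 !scale1r. Qed.

Lemma specialisesX m : specialises 'X_[m] 'X_[m].
Proof. by have := specialises_map 'X_[m]; rewrite !map_mpolyX. Qed.

Lemma specialises0 : specialises 0 0.
Proof. by have := specialises_map 0; rewrite !raddf0. Qed.

Lemma specialisesB f h f' h' : specialises f f' -> specialises h h' ->
  specialises (f - h) (f' - h').
Proof.
move=> sf sh; rewrite -mulN1r -[- h']mulN1r; apply: specialisesD => //.
by apply: specialisesM => //; have := specialises_map (-1); rewrite !rmorphN1.
Qed.

Lemma specialises_mulmx p q r (A : 'M_(p, q)) (B : 'M_(q, r))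
    (A' : 'M_(p, q)) (B' : 'M_(q, r)) :
  (forall i j, specialises (A i j) (A' i j)) -> (forall i j, specialises (B i j) (B' i j)) ->
  forall i j, specialises ((A *m B) i j) ((A' *m B') i j).
Proof.
move=> sA sB i j; rewrite !mxE; apply: (big_ind2 specialises) => [|????|l _].
- exact: specialises0.
- exact: specialisesD.
- exact: specialisesM.
Qed.

Lemma specialises_supported S f f' : specialises f f' -> supported S f -> supported S f'.
Proof.
move=> [q [ft [q0 Ef Ea]]] Sf m mf'; apply: Sf; move: mf'; rewrite !mcoeff_msupp.
apply: contra_neq => fm.
have ftm : ft@_m = 0.
  apply/eqP; rewrite -(inj_eq phi_inj) raddf0 -mcoeff_map_mpoly -Ef mcoeffZ fm mulr0.
  exact: eqxx.
have := congr1 (mcoeff m) Ea; rewrite mcoeffZ mcoeff_map_mpoly ftm raddf0.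
by move/eqP; rewrite mulf_eq0 (negbTE q0) => /eqP.
Qed.

(** The support can only shrink, and the coefficient 1 of the mark persists. *)
Lemma specialises_marked t (f : {mpoly L[n.+1]}) f' : specialises f f' ->
  marked_at t f -> marked_at t f'.
Proof.
move=> sf [hf f1 lf]; have sfX := specialisesB sf (specialisesX t); split.
- by apply/homog_supported; apply: specialises_supported sf _; apply/homog_supported.
- apply/eqP; rewrite -subr_eq0 -[X in _ - X](_ : ('X_[t] : {mpoly K[n.+1]})@_t = 1); last first.
    by rewrite mcoeffX eqxx.
  rewrite -mcoeffB mcoeff_eq0; apply/negP => ht.
  by have := specialises_supported sfX lf ht; rewrite ltxx.
- exact: specialises_supported sfX lf.
Qed.

Lemma specialises_generic h : specialises (genericL phi h) (coord_map idfun g h).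
Proof.
rewrite genericLE; have := specialises_map (generic_coord h); congr specialises.
rewrite (map_coord_map (kappa' := idfun)) => [|c]; last by rewrite /= /eval_at mmapC.
congr (coord_map _ _ _); apply/matrixP => i j.
by rewrite mxE -[generic_mx n K i j]mxvecE mxvec_generic /= /eval_at mmapX mmap1U mxvecE.
Qed.

Definition special_value f : {mpoly K[n.+1]} := epsilon (inhabits 0) (specialises f).

Lemma special_valueP p f : clearable phi p f -> eval_at p != 0 ->
  specialises f (special_value f).
Proof.
move=> [ft Ef] p0; apply: epsilon_spec; exists ((eval_at p)^-1 *: map_mpoly eval_at ft).
by exists p, ft; rewrite scalerA mulfV // scale1r.
Qed.

End Specialisation.

(** * Marked bases from the generic point *)

Lemma fraction_quotient (T : idomainType) (x : {fraction T}) : exists q t,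
  q != 0 /\ FracField.tofrac q * x = FracField.tofrac t.
Proof.
elim/quotW: x => r; exists (frac r).2, (frac r).1; split; first exact: denom_ratioP.
unlock FracField.tofrac; rewrite -[LHS]FracField.pi_mul; apply/eqmodP => /=.
rewrite FracField.equivfE /FracField.mulf !numden_Ratio ?(mulf_neq0, oner_eq0, denom_ratioP) //.
by rewrite !mul1r mulr1 mulrC.
Qed.

(** Hilbert's basis theorem: Dickson's lemma for the leading terms. *)
Lemma ideal_finitely_generated n (K : fieldType) (I : {mpoly K[n.+1]} -> Prop) :
  graded_ideal I -> exists r, exists H : 'rV[{mpoly K[n.+1]}]_r,
    (forall j, I (H ord0 j)) /\ forall f, I f -> row_image H f.
Proof.
move=> [idI grI]; have [P [_ PE dom]] := dickson (lead_set I).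
pose F t : {mpoly K[n.+1]} := epsilon (inhabits 0) (fun F => I F /\ marked_at t F).
have hF t : t \in P -> I (F t) /\ marked_at t (F t).
  move=> /PE [St _].
  exact: (@epsilon_spec _ (inhabits 0) (fun F => I F /\ marked_at t F) (lead_set_rep idI St)).
exists (size P), (marked_row P F); split=> [j|f If].
  by rewrite mxE; have [] := hF _ (hd_of_in j).
rewrite (pihomog_partitionE (leqnn (msize f))).
have [im0 imD _] := row_image_ideal (marked_row P F).
apply: (big_ind (row_image (marked_row P F))) => // d _.
have Fm t : t \in P -> marked_at t (F t) by move=> /hF [].
have FI t : t \in P -> I (F t) by move=> /hF [].
by apply: (graded_generated Fm idI FI dom (grI _ _ If)); apply: pihomogP.
Qed.

Lemma image_ideal_ideal n (K : fieldType) (I : {mpoly K[n.+1]} -> Prop) g :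
  g \in unitmx -> is_ideal I -> is_ideal (image_ideal g I).
Proof.
move=> gu [I0 ID IM]; split.
- by exists 0 => //; rewrite change_coordE raddf0.
- move=> _ _ [f If ->] [h Ih ->]; exists (f + h); first exact: ID.
  by rewrite !change_coordE raddfD.
- move=> a _ [f If ->]; exists (coord_map idfun (invmx g) a * f); first exact: IM.
  by rewrite !change_coordE rmorphM /= coord_map_comp mulVmx // coord_map1.
Qed.

Section GenericData.
Variables (n : nat) (K : fieldType) (I : {mpoly K[n.+1]} -> Prop).
Notation N := (n.+1 * n.+1)%N.
Notation T := {mpoly K[N]}.
Notation L := {fraction T}.
Notation phi := (@FracField.tofrac T : {rmorphism T -> L}).
Notation theta := (@genericL n K L phi).

Lemma tofrac_inj : injective phi.
Proof. by move=> a b /eqP; rewrite tofrac_eq => /eqP. Qed.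

(** What has to survive specialisation: marks, supports, rewriting rules, and the two
    factorisations which say that [H] and the marked elements generate the same
    ideal. *)
Definition generic_marked_data r (H : 'rV[{mpoly K[n.+1]}]_r)
    (S : 'X_{1..n.+1} -> Prop) (P : seq 'X_{1..n.+1})
    (F : 'X_{1..n.+1} -> {mpoly L[n.+1]}) : Prop :=
  [/\ forall t, t \in P -> marked_at t (F t),
      forall t, t \in P -> supported (fun m => ~ S m) (F t - 'X_[t]),
      rewritable (marked_row P F) (@hd_of n P) (@lev_of n P),
      exists B : 'M_(size P, r), map_mx theta H = marked_row P F *m B
    & exists B : 'M_(r, size P), marked_row P F = map_mx theta H *m B].

Lemma row_factor (E : fieldType) r s (A : 'rV[{mpoly E[n.+1]}]_r) (B : 'rV_s) :
  (forall j, row_image A (B ord0 j)) -> exists C : 'M_(r, s), B = A *m C.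
Proof.
move=> h; have [c hc] := fin_all_exists h; exists (\matrix_(i, j) c j i ord0).
apply/matrixP => i j; rewrite (ord1 i) hc !mxE; apply: eq_bigr => l _.
by rewrite mxE.
Qed.

Lemma generic_data_exists : componentwise_linear I ->
  exists r (H : 'rV[{mpoly K[n.+1]}]_r) S P F,
  [/\ forall j, I (H ord0 j), forall f, I f -> row_image H f,
     up_closed S /\ stable_set S,
     uniq P /\ (forall m, m \in P <-> S m /\ forall m', S m' -> (m' <= m)%MM -> m' = m) /\
       (forall m, S m -> exists2 t, t \in P & (t <= m)%MM)
   & generic_marked_data H S P F].
Proof.
move=> [gI linI]; have [idI grI] := gI; have [r [H [HI IH]]] := ideal_finitely_generated gI.
pose II := generic_ideal phi I; pose S := lead_set II.
have idII : is_ideal II := ideal_gen_ideal _.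
have frac := @fraction_quotient T.
have cancel d (k : 'I_n.+1) a w : a \is d.-homog -> ideal_of_degree II d w ->
    low k ('X_k * a - w) -> exists b, [/\ II b, b \is d.-homog & low k (a - b)].
  by move=> ha; apply: (generic_cancel tofrac_inj frac gI (linI d) ha).
have S_up : up_closed S := lead_set_up idII.
have S_stable : stable_set S := lead_set_stable cancel.
have [P [uP PE dom]] := dickson S.
pose F t : {mpoly L[n.+1]} := epsilon (inhabits 0) (fun F =>
  [/\ II F, marked_at t F & supported (fun m => ~ S m) (F - 'X_[t])]).
have hF t : t \in P -> [/\ II (F t), marked_at t (F t)
    & supported (fun m => ~ S m) (F t - 'X_[t])].
  by move=> /PE [St _]; exact: (@epsilon_spec _ (inhabits 0) (fun F =>
    [/\ II F, marked_at t F & supported (fun m => ~ S m) (F - 'X_[t])]) (reduced_rep idII St)).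
have FII t : t \in P -> II (F t) by move=> /hF [].
have Fm t : t \in P -> marked_at t (F t) by move=> /hF [].
have gens f : II f -> row_image (map_mx theta H) f.
  apply: (ideal_gen_min (row_image_ideal _)) => g [h /IH [u ->] ->].
  by exists (map_mx theta u); rewrite -map_mxM [RHS]mxE.
have [_ gensP _] := row_image_ideal (marked_row P F).
exists r, H, S, P, F; split=> //; split.
- exact: Fm.
- by move=> t /hF [].
- by apply: (marked_row_rewritable idII cancel) => // m; apply: (stable_cone S_up S_stable PE).
- apply: row_factor => j; rewrite mxE.
  have IHj : II (theta (H ord0 j)) by apply: ideal_gen_in; exists (H ord0 j).
  rewrite [H ord0 j](pihomog_partitionE (leqnn (msize (H ord0 j)))) raddf_sum.
  have [im0 imD _] := row_image_ideal (marked_row P F).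
  apply: (big_ind (row_image (marked_row P F))) => // d _.
  have dom' m : S m -> exists2 t, t \in P & (t <= m)%MM by apply: dom.
  have IHd : II (theta (pihomog mdeg d (H ord0 j))).
    by apply: ideal_gen_in; exists (pihomog mdeg d (H ord0 j)) => //; apply: grI.
  apply: (graded_generated Fm idII FII dom' IHd (d := d)).
  by rewrite /genericL coord_map_homog // pihomogP.
- by apply: row_factor => k; rewrite mxE; apply/gens/FII/hd_of_in.
Qed.

(** All these conditions are either bounds on supports or identities between
    finitely many polynomials over the field of fractions; [p] is a common
    denominator of the latter. *)
Lemma specialise_data r (H : 'rV[{mpoly K[n.+1]}]_r) S P F : generic_marked_data H S P F ->
  exists2 p : T, p != 0 & forall g : 'M[K]_n.+1, eval_at g p != 0 ->
  exists F' : 'X_{1..n.+1} -> {mpoly K[n.+1]},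
    [/\ forall t, t \in P -> marked_at t (F' t),
        forall t, t \in P -> supported (fun m => ~ S m) (F' t - 'X_[t]),
        rewritable (marked_row P F') (@hd_of n P) (@lev_of n P),
        forall j, row_image (marked_row P F') (coord_map idfun g (H ord0 j))
      & forall t, t \in P -> row_image (map_mx (coord_map idfun g) H) (F' t)].
Proof.
move=> [Fm Fr /rewritable_choice [Q hQ] [B EB] [B' EB']].
have frac := @fraction_quotient T.
have [p1 p10 h1] := clear_family frac (fun k : 'I_(size P) => F (hd_of k)).
have [p2 p20 h2] := clear_family frac (fun ij : 'I_(size P) * 'I_r => B ij.1 ij.2).
have [p3 p30 h3] := clear_family frac (fun ij : 'I_r * 'I_(size P) => B' ij.1 ij.2).
have [p4 p40 h4] := clear_family frac
  (fun x : ('I_(size P) * 'I_n.+1) * 'I_(size P) => Q x.1.1 x.1.2 x.2 ord0).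
exists (p1 * p2 * (p3 * p4)) => [|g]; first by rewrite !mulf_neq0.
rewrite !rmorphM !mulf_eq0 !negb_or => /andP [/andP [e1 e2] /andP [e3 e4]].
pose sv := special_value (phi : {rmorphism T -> L}) g.
have s1 t : t \in P -> specialises phi g (F t) (sv (F t)).
  by move=> /hd_of_ex [k <-]; apply: special_valueP (h1 k) e1.
have s2 i j : specialises phi g (B i j) (map_mx sv B i j).
  by rewrite mxE; apply: special_valueP (h2 (i, j)) e2.
have s3 i j : specialises phi g (B' i j) (map_mx sv B' i j).
  by rewrite mxE; apply: special_valueP (h3 (i, j)) e3.
have s4 k i a b : specialises phi g (Q k i a b) (map_mx sv (Q k i) a b).
  by rewrite mxE (ord1 b); apply: special_valueP (h4 (k, i, a)) e4.
pose F' t := sv (F t); have sA i j : specialises phi g (marked_row P F i j) (marked_row P F' i j).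
  by rewrite !mxE; apply: s1; apply: hd_of_in.
have sH i j : specialises phi g (map_mx theta H i j) (map_mx (coord_map idfun g) H i j).
  by rewrite !mxE; apply: specialises_generic.
have uniq_spec := @specialises_uniq _ _ _ phi tofrac_inj g.
exists F'; split.
- by move=> t tP; apply: (specialises_marked tofrac_inj (s1 t tP)); apply: Fm.
- move=> t tP; apply: (specialises_supported tofrac_inj _ (Fr t tP)).
  by apply: specialisesB; [apply: s1 | apply: specialisesX].
- move=> k i ki; have [q1 q2 q3] := hQ k i ki; exists (map_mx sv (Q k i)); split.
  + apply/matrixP => a b; rewrite (ord1 a) (ord1 b).
    apply: (uniq_spec ((marked_row P F *m Q k i) ord0 ord0)); last exact: specialises_mulmx.
    rewrite -q1 !mxE; apply: specialisesM; first exact: specialisesX.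
    by apply: s1; apply: hd_of_in.
  + by move=> l; apply: (specialises_supported tofrac_inj (s4 _ _ _ _) (q2 l)).
  + by move=> l; apply: (specialises_supported tofrac_inj (s4 _ _ _ _) (q3 l)).
- move=> j; exists (col j (map_mx sv B)); rewrite -col_mulmx [RHS]mxE.
  apply: (uniq_spec ((marked_row P F *m B) ord0 j)); last exact: specialises_mulmx.
  by rewrite -EB !mxE; apply: specialises_generic.
- move=> t tP; have [k <-] := hd_of_ex tP; exists (col k (map_mx sv B')).
  rewrite -col_mulmx [RHS]mxE.
  apply: (uniq_spec ((map_mx theta H *m B') ord0 k)); last exact: specialises_mulmx.
  by rewrite -EB' mxE; apply: s1; apply: hd_of_in.
Qed.

End GenericData.

Theorem theorem3p13 (n : nat) (K : fieldType) (I : {mpoly K[n.+1]} -> Prop)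
    (hI : componentwise_linear I) :
  exists Z : {mpoly K[n.+1 * n.+1]} -> Prop,
    open_nonempty Z /\
    forall g : 'M[K]_n.+1, open_rational_point Z g ->
      exists (J : {mpoly K[n.+1]} -> Prop) (P : seq 'X_{1..n.+1})
             (F : 'X_{1..n.+1} -> {mpoly K[n.+1]}) (C : complex n K),
        [/\ stable J,
            marked_basis J P F,
            generates (marked_elements P F) (image_ideal g I),
            marked_resolution P F C
          & minimal C].
Proof.
have [[idI _] _] := hI.
have [r [H [S [P [F [HI IH [S_up S_stable] [uP [PE dom]] data]]]]]] := generic_data_exists hI.
have [p p0 spec] := specialise_data data.
exists (fun q => q = p); split.
  pose T := {mpoly K[n.+1 * n.+1]}; pose phi : {rmorphism T -> {fraction T}} := @FracField.tofrac T.
  exists {fraction T}, (scalar_ext phi), (generic_point phi).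
  split; first exact: generic_point_unit (@tofrac_inj n K).
  exists p => //; rewrite [X in X != 0](_ : _ = phi p); first by rewrite tofrac_eq0.
  apply: (mpoly_hom_eq (phi := mmap (scalar_ext phi) _)) => [c|i] /=; first by rewrite mmapC.
  by rewrite mmapX mmap1U /generic_point -map_mxvec mxE mxvec_generic.
move=> g [gu [_ -> pg]]; have [F' [Fm Fr Frw HF FH]] := spec g pg.
have [C [resC minC]] := stable_resolution uP PE Fm Frw.
exists (supported S), P, F', C; split=> //.
- exact: stable_supported dom.
- exact: stable_marked_basis.
have idg := image_ideal_ideal gu idI.
move=> f; split.
  move=> [h /IH [u ->] ->]; rewrite change_coordE; apply/marked_elements_gen => //.
  have imI := row_image_ideal (marked_row P F').
  rewrite mxE raddf_sum; have [im0 imD imM] := imI.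
  apply: (big_ind (row_image (marked_row P F'))) => // j _.
  by rewrite /= rmorphM mulrC; apply: imM; apply: HF.
apply: (ideal_gen_min idg) => t' [t tP ->]; have [u ->] := FH t tP.
have [im0 imD imM] := idg.
rewrite mxE; apply: (big_ind (image_ideal g I)) => // j _.
rewrite mulrC; apply: imM; rewrite mxE; exists (H ord0 j) => //.
by rewrite change_coordE.
Qed.
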